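(* Let $n,m\ge 1$ be integers and let $\varpi_1$ be the first fundamental weight of $\mathfrak{gl}_n$. Then there exists an isomorphism of $S(\mathfrak{gl}_n^* )^{\mathfrak{gl}_n}$-algebras $$\mathscr{B}(m\varpi_1)\simeq S^m(\mathscr{B}(\varpi_1)),$$ where $S^m(\mathscr{B}(\varpi_1))$ denotes the subalgebra $(\mathscr{B}(\varpi_1)^{\otimes m})^{\mathfrak{S}_m}$ of $\mathfrak{S}_m$-invariants (for the permutation of tensor factors) in the $m$-th tensor power $\mathscr{B}(\varpi_1)^{\otimes m}$, the tensor products being taken over $S(\mathfrak{gl}_n^* )^{\mathfrak{gl}_n}$.
   Context: Let $\mathfrak{gl}_n$ be the Lie algebra of complex $n\times n$ matrices, with matrix units $E_{ij}$ and corresponding coordinate functions $y_{ij}$, so that $S(\mathfrak{gl}_n^* )=\mathbb{C}[\mathfrak{gl}_n]=\mathbb{C}[y_{ij}]$. For $0\le k\le n$ let $c_k(Y)$ be the sum of the principal $k\times k$ minors of $Y$; $c_1,\dots,c_n$ freely generate $S(\mathfrak{gl}_n^* )^{\mathfrak{gl}_n}$. For a representation $V$ of $\mathrm{GL}_n$ with associated $\pi:\mathfrak{gl}_n\to\mathrm{End}\,V$, the Kirillov algebra $\mathscr{C}(V)=(S(\mathfrak{gl}_n^* )\otimes\mathrm{End}\,V)^{\mathrm{GL}_n}$ is the algebra of $\mathrm{GL}_n$-equivariant polynomial maps $\mathfrak{gl}_n\to\mathrm{End}\,V$. It is an $S(\mathfrak{gl}_n^* )^{\mathfrak{gl}_n}$-algebra,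 with $c\in S(\mathfrak{gl}_n^* )^{\mathfrak{gl}_n}$ identified with $Y\mapsto c(Y)\,\mathrm{Id}_V$. The Kirillov--Wei operator on $\mathscr{C}(V)$ is $(\mathbf{D}F)(Y)=\sum_{i,j=1}^n\frac{\partial F}{\partial y_{ji}}(Y)\cdot\pi(E_{ij})$. The big algebra $\mathscr{B}(V)$ is the subalgebra of $\mathscr{C}(V)$ generated by $\mathbf{D}^q(c_{p+q})$ for $p,q\ge 0$, $p+q\le n$. For a dominant integral weight $\lambda$, $\mathscr{B}(\lambda):=\mathscr{B}(V(\lambda))$ with $V(\lambda)$ the irreducible representation of highest weight $\lambda$; here $V(\varpi_1)=\mathbb{C}^n$ is the vector representation and $V(m\varpi_1)=S^m(\mathbb{C}^n)$. *)

(* Defs.v *)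
From HB Require Import structures.
From mathcomp Require Import all_boot all_order all_algebra perm.
From mathcomp Require Import generic_quotient ring_quotient.
From mathcomp Require Import boolp reals.
From mathcomp Require Import complex mpoly freeg.

Set Implicit Arguments.
Unset Strict Implicit.
Unset Printing Implicit Defensive.

Import GRing.Theory.
Local Open Scope ring_scope.
Local Open Scope quotient_scope.

(* Associative unital A-algebras, as rings B with a central structure map from
   A.  The library's [algType A] is not used because it requires 1 != 0, which
   cannot be granted to a tensor power of an arbitrary algebra. *)
Record algebra (A : comNzRingType) := Algebra {
  alg_ring :> pzRingType;
  alg_map : {rmorphism A -> alg_ring};
  alg_central : forall a (x : alg_ring), alg_map a * x = x * alg_map a
}.

Definition alg_isom (A : comNzRingType) (B C : algebra A) : Prop :=
  exists f : {rmorphism B -> C},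
    bijective f /\ forall a, f (alg_map B a) = alg_map C a.

Section TensorPower.
Variables (A : comNzRingType) (B : algebra A) (m : nat).

Local Notation pure := {ffun 'I_m -> B}.
Local Notation formal := {freeg pure / A}.

(* The submodule of the free A-module on B^m that is spanned by the
   multilinearity relations; the m-th tensor power of B is the quotient. *)
Inductive tensor_null : formal -> Prop :=
| tensor_null0 : tensor_null 0
| tensor_null_lin (a : A) (u v : formal) :
    tensor_null u -> tensor_null v -> tensor_null (a *: u + v)
| tensor_null_add (k : 'I_m) (b b1 b2 : pure) :
    b k = b1 k + b2 k ->
    (forall j, j != k -> b1 j = b j /\ b2 j = b j) ->
    tensor_null (<< b >> - (<< b1 >> + << b2 >>))
| tensor_null_scale (k : 'I_m) (a : A) (b b1 : pure) :
    b k = alg_map B a * b1 k ->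
    (forall j, j != k -> b1 j = b j) ->
    tensor_null (<< b >> - a *: << b1 >>).

Definition tensor_null_pred : pred formal := fun u => `[< tensor_null u >].

Lemma tensor_nullP u : reflect (tensor_null u) (u \in tensor_null_pred).
Proof. exact: asboolP. Qed.

Lemma tensor_nullZ a u : tensor_null u -> tensor_null (a *: u).
Proof.
by move=> u0; rewrite -[a *: u]addr0; apply: tensor_null_lin u0 tensor_null0.
Qed.

Lemma tensor_nullD u v : tensor_null u -> tensor_null v -> tensor_null (u + v).
Proof. by move=> u0 v0; rewrite -[u]scale1r; apply: tensor_null_lin. Qed.

Lemma tensor_nullB u v : tensor_null u -> tensor_null v -> tensor_null (u - v).
Proof.
by move=> u0 v0; rewrite addrC -scaleN1r; apply: tensor_null_lin.
Qed.

Fact tensor_null_zmod_closed : zmod_closed tensor_null_pred.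
Proof.
split; first exact/tensor_nullP/tensor_null0.
by move=> u v /tensor_nullP u0 /tensor_nullP v0; apply/tensor_nullP/tensor_nullB.
Qed.

HB.instance Definition _ :=
  GRing.isZmodClosed.Build formal tensor_null_pred tensor_null_zmod_closed.

Definition tensor_power : Type := Quotient.quot (GRing.ZmodClosed.clone formal tensor_null_pred _).

HB.instance Definition _ := GRing.Zmodule.on tensor_power.

Definition tensor_pi (u : formal) : tensor_power :=
  \pi_(Quotient.quot (GRing.ZmodClosed.clone formal tensor_null_pred _)) u.
Definition tensor_repr (t : tensor_power) : formal := repr t.

Lemma tensor_reprK t : tensor_pi (tensor_repr t) = t.
Proof. exact: reprK. Qed.

Lemma tensor_piP u v : tensor_pi u = tensor_pi v <-> tensor_null (u - v).
Proof.
split=> [/eqP|/tensor_nullP]; first by rewrite -Quotient.idealrBE => /tensor_nullP.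
by rewrite Quotient.idealrBE => /eqP.
Qed.

Lemma tensor_null_repr u : tensor_null (tensor_repr (tensor_pi u) - u).
Proof. by apply/tensor_piP; rewrite tensor_reprK. Qed.

Fact tensor_pi_zmod_morphism : zmod_morphism tensor_pi.
Proof. exact: raddfB. Qed.

HB.instance Definition _ :=
  GRing.isZmodMorphism.Build formal tensor_power tensor_pi
    tensor_pi_zmod_morphism.

Lemma formal_ind (P : formal -> Prop) :
  P 0 -> (forall a x u, P u -> P (a *: << x >> + u)) -> forall u, P u.
Proof.
move=> P0 PD u; rewrite -[u]freeg_sumE; elim: (dom u) => [|x s IHs].
  by rewrite big_nil.
rewrite big_cons (_ : << _ *g x >> = coeff x u *: << x >>); first exact: PD.
by apply/eqP/freeg_eqP => y; rewrite coeffZ !coeffU mul1r.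
Qed.

Section Lift.
Variables (M : lmodType A) (f : pure -> M).

Lemma fgliftU x : fglift f << x >> = f x.
Proof. by rewrite liftU scale1r. Qed.

Lemma fgliftB u v : fglift f (u - v) = fglift f u - fglift f v.
Proof. exact: lift_is_additive. Qed.

Lemma fglift0 : fglift f 0 = 0.
Proof. by rewrite -(subrr 0) fgliftB subrr. Qed.

Lemma fgliftD u v : fglift f (u + v) = fglift f u + fglift f v.
Proof. by rewrite -{1}[v]opprK fgliftB -[- v]sub0r fgliftB fglift0 sub0r opprK. Qed.

Lemma fgliftZ a u : fglift f (a *: u) = a *: fglift f u.
Proof.
elim/formal_ind: u => [|c x u IHu]; first by rewrite scaler0 fglift0 scaler0.
have sU b : b *: (<< x >> : formal) = << b *g x >>.
  by apply/eqP/freeg_eqP => y; rewrite coeffZ !coeffU mul1r.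
by rewrite scalerDr !fgliftD IHu scalerA !sU !liftU scalerDr scalerA.
Qed.

End Lift.

Definition pure_mul (x y : pure) : pure := [ffun k => x k * y k].
Definition formal_mul (u v : formal) : formal :=
  fglift (fun x => fglift (fun y => << pure_mul x y >>) v) u.
Definition formal_one : formal := << [ffun=> 1] >>.

Definition tensor_mul (s t : tensor_power) : tensor_power :=
  tensor_pi (formal_mul (tensor_repr s) (tensor_repr t)).
Definition tensor_one : tensor_power := tensor_pi formal_one.

Lemma formal_mul0l v : formal_mul 0 v = 0. Proof. exact: fglift0. Qed.
Lemma formal_mulDl u u' v :
  formal_mul (u + u') v = formal_mul u v + formal_mul u' v.
Proof. exact: fgliftD. Qed.
Lemma formal_mulBl u u' v :
  formal_mul (u - u') v = formal_mul u v - formal_mul u' v.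
Proof. exact: fgliftB. Qed.
Lemma formal_mulZl a u v : formal_mul (a *: u) v = a *: formal_mul u v.
Proof. exact: fgliftZ. Qed.
Lemma formal_mulUl x v :
  formal_mul << x >> v = fglift (fun y => << pure_mul x y >>) v.
Proof. exact: fgliftU. Qed.
Lemma formal_mulUU x y : formal_mul << x >> << y >> = << pure_mul x y >>.
Proof. by rewrite formal_mulUl fgliftU. Qed.

Lemma formal_mul0r u : formal_mul u 0 = 0.
Proof.
elim/formal_ind: u => [|a x u IHu]; first exact: formal_mul0l.
by rewrite formal_mulDl formal_mulZl formal_mulUl fglift0 scaler0 IHu addr0.
Qed.

Lemma formal_mulDr u v v' :
  formal_mul u (v + v') = formal_mul u v + formal_mul u v'.
Proof.
elim/formal_ind: u => [|a x u IHu]; first by rewrite !formal_mul0l addr0.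
by rewrite !formal_mulDl IHu !formal_mulZl !formal_mulUl fgliftD scalerDr addrACA.
Qed.

Lemma formal_mulZr a u v : formal_mul u (a *: v) = a *: formal_mul u v.
Proof.
elim/formal_ind: u => [|c x u IHu]; first by rewrite !formal_mul0l scaler0.
rewrite !formal_mulDl IHu !formal_mulZl !formal_mulUl fgliftZ scalerDr.
by rewrite !scalerA mulrC.
Qed.

Lemma formal_mulBr u v v' :
  formal_mul u (v - v') = formal_mul u v - formal_mul u v'.
Proof. by rewrite formal_mulDr -!scaleN1r formal_mulZr. Qed.

Lemma formal_mulA u v w :
  formal_mul u (formal_mul v w) = formal_mul (formal_mul u v) w.
Proof.
elim/formal_ind: u => [|a x u IHu]; first by rewrite !formal_mul0l.
rewrite !formal_mulDl !formal_mulZl IHu; congr (a *: _ + _) => {a u IHu}.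
elim/formal_ind: v => [|a y v IHv]; first by rewrite !(formal_mul0l, formal_mul0r).
rewrite !(formal_mulDl, formal_mulDr) !(formal_mulZl, formal_mulZr) IHv.
congr (a *: _ + _) => {a v IHv}.
elim/formal_ind: w => [|a z w IHw]; first by rewrite !formal_mul0r.
rewrite !formal_mulDr !formal_mulZr IHw !formal_mulUU; congr (a *: << _ >> + _).
by apply/ffunP => k; rewrite !ffunE mulrA.
Qed.

Lemma formal_mul1l u : formal_mul formal_one u = u.
Proof.
elim/formal_ind: u => [|a x u IHu]; first exact: formal_mul0r.
rewrite formal_mulDr formal_mulZr IHu formal_mulUU; congr (a *: << _ >> + _).
by apply/ffunP => k; rewrite !ffunE mul1r.
Qed.

Lemma formal_mul1r u : formal_mul u formal_one = u.
Proof.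
elim/formal_ind: u => [|a x u IHu]; first exact: formal_mul0l.
rewrite formal_mulDl formal_mulZl IHu formal_mulUU; congr (a *: << _ >> + _).
by apply/ffunP => k; rewrite !ffunE mulr1.
Qed.

Lemma tensor_null_mull u v : tensor_null u -> tensor_null (formal_mul u v).
Proof.
move=> u0; elim/formal_ind: v => [|a y v IHv].
  by rewrite formal_mul0r; apply: tensor_null0.
rewrite formal_mulDr formal_mulZr; apply: tensor_null_lin IHv.
elim: u0 => {u v} [|c u v _ IHu _ IHv|k b b1 b2 bk bj|k c b b1 bk bj].
- by rewrite formal_mul0l; apply: tensor_null0.
- by rewrite formal_mulDl formal_mulZl; apply: tensor_null_lin.
- rewrite formal_mulBl formal_mulDl !formal_mulUU.
  apply: (tensor_null_add (k := k)); first by rewrite !ffunE bk mulrDl.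
  by move=> j /bj[b1j b2j]; rewrite !ffunE b1j b2j.
- rewrite formal_mulBl formal_mulZl !formal_mulUU.
  apply: (tensor_null_scale (k := k)); first by rewrite !ffunE bk mulrA.
  by move=> j /bj b1j; rewrite !ffunE b1j.
Qed.

Lemma tensor_null_mulr u v : tensor_null v -> tensor_null (formal_mul u v).
Proof.
move=> v0; elim/formal_ind: u => [|a y u IHu].
  by rewrite formal_mul0l; apply: tensor_null0.
rewrite formal_mulDl formal_mulZl; apply: tensor_null_lin IHu.
elim: v0 => {u v} [|c u v _ IHu _ IHv|k b b1 b2 bk bj|k c b b1 bk bj].
- by rewrite formal_mul0r; apply: tensor_null0.
- by rewrite formal_mulDr formal_mulZr; apply: tensor_null_lin.
- rewrite formal_mulBr formal_mulDr !formal_mulUU.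
  apply: (tensor_null_add (k := k)); first by rewrite !ffunE bk mulrDr.
  by move=> j /bj[b1j b2j]; rewrite !ffunE b1j b2j.
- rewrite formal_mulBr formal_mulZr !formal_mulUU.
  apply: (tensor_null_scale (k := k)); last first.
    by move=> j /bj b1j; rewrite !ffunE b1j.
  by rewrite !ffunE bk !mulrA alg_central.
Qed.

Lemma tensor_piM u v :
  tensor_pi (formal_mul u v) = tensor_mul (tensor_pi u) (tensor_pi v).
Proof.
apply/esym/tensor_piP; set u' := tensor_repr _; set v' := tensor_repr _.
rewrite -[X in tensor_null X](subrKA (formal_mul u v')) -formal_mulBl -formal_mulBr.
by apply: tensor_nullD;
  [apply: tensor_null_mull|apply: tensor_null_mulr]; apply: tensor_null_repr.
Qed.

Fact tensor_mulA : associative tensor_mul.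
Proof.
move=> s t r; rewrite -[s]tensor_reprK -[t]tensor_reprK -[r]tensor_reprK.
by rewrite -!tensor_piM formal_mulA.
Qed.

Fact tensor_mul1l : left_id tensor_one tensor_mul.
Proof. by move=> s; rewrite -[s]tensor_reprK -tensor_piM formal_mul1l. Qed.

Fact tensor_mul1r : right_id tensor_one tensor_mul.
Proof. by move=> s; rewrite -[s]tensor_reprK -tensor_piM formal_mul1r. Qed.

Fact tensor_mulDl : left_distributive tensor_mul +%R.
Proof.
move=> s t r; rewrite -[s]tensor_reprK -[t]tensor_reprK -[r]tensor_reprK.
by rewrite -raddfD -!tensor_piM -raddfD formal_mulDl.
Qed.

Fact tensor_mulDr : right_distributive tensor_mul +%R.
Proof.
move=> s t r; rewrite -[s]tensor_reprK -[t]tensor_reprK -[r]tensor_reprK.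
by rewrite -raddfD -!tensor_piM -raddfD formal_mulDr.
Qed.

HB.instance Definition _ := GRing.Zmodule_isPzRing.Build tensor_power
  tensor_mulA tensor_mul1l tensor_mul1r tensor_mulDl tensor_mulDr.

Definition tensor_map (a : A) : tensor_power := tensor_pi (a *: formal_one).

Fact tensor_map_zmod_morphism : zmod_morphism tensor_map.
Proof. by move=> a b; rewrite /tensor_map scalerBl raddfB. Qed.

Fact tensor_map_monoid_morphism : monoid_morphism tensor_map.
Proof.
split; first by rewrite /tensor_map scale1r.
move=> a b; rewrite -[RHS]tensor_piM formal_mulZl formal_mul1l.
by rewrite /tensor_map scalerA.
Qed.

HB.instance Definition _ :=
  GRing.isZmodMorphism.Build A tensor_power tensor_map tensor_map_zmod_morphism.
HB.instance Definition _ :=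
  GRing.isMonoidMorphism.Build A tensor_power tensor_map
    tensor_map_monoid_morphism.

Fact tensor_central a (t : tensor_power) : tensor_map a * t = t * tensor_map a.
Proof.
rewrite -[t]tensor_reprK -[LHS]tensor_piM -[RHS]tensor_piM.
by rewrite formal_mulZl formal_mulZr formal_mul1l formal_mul1r.
Qed.

Definition tensor_alg : algebra A := Algebra tensor_central.

(* This is a right action of 'S_m; its invariants are those of the left action
   by the inverse permutations. *)
Definition pure_perm (s : 'S_m) (x : pure) : pure := [ffun k => x (s k)].
Definition formal_perm (s : 'S_m) (u : formal) : formal :=
  fglift (fun x : pure => << pure_perm s x >>) u.
Definition tensor_perm (s : 'S_m) (t : tensor_power) : tensor_power :=
  tensor_pi (formal_perm s (tensor_repr t)).

Lemma tensor_null_perm s u : tensor_null u -> tensor_null (formal_perm s u).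
Proof.
elim=> {u} [|c u v _ IHu _ IHv|k b b1 b2 bk bj|k c b b1 bk bj].
- by rewrite [formal_perm _ _]fglift0; apply: tensor_null0.
- by rewrite [formal_perm _ _]fgliftD fgliftZ; apply: tensor_null_lin.
- rewrite [formal_perm _ _]fgliftB fgliftD !fgliftU.
  apply: (tensor_null_add (k := (s^-1)%g k)); first by rewrite !ffunE permKV.
  move=> j jk; rewrite !ffunE; apply: bj; apply: contra jk => /eqP <-.
  by rewrite permK.
- rewrite [formal_perm _ _]fgliftB fgliftZ !fgliftU.
  apply: (tensor_null_scale (k := (s^-1)%g k)); first by rewrite !ffunE permKV.
  move=> j jk; rewrite !ffunE; apply: bj; apply: contra jk => /eqP <-.
  by rewrite permK.
Qed.

Lemma tensor_pi_perm s u : tensor_pi (formal_perm s u) = tensor_perm s (tensor_pi u).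
Proof.
apply/esym/tensor_piP; rewrite -[X in tensor_null X]fgliftB.
exact/tensor_null_perm/tensor_null_repr.
Qed.

Lemma formal_permM s u v :
  formal_perm s (formal_mul u v) = formal_mul (formal_perm s u) (formal_perm s v).
Proof.
elim/formal_ind: u => [|a x u IHu].
  by rewrite formal_mul0l [formal_perm s 0]fglift0 formal_mul0l.
rewrite formal_mulDl formal_mulZl ![formal_perm s (_ + _)]fgliftD !fgliftZ.
rewrite !formal_mulDl !formal_mulZl; congr (a *: _ + _); last exact: IHu.
elim/formal_ind: v {u IHu} => [|c y v IHv].
  by rewrite formal_mul0r [formal_perm s 0]fglift0 fglift0 formal_mul0r.
rewrite formal_mulDr formal_mulZr [formal_perm s (_ + _)]fgliftD !fgliftD !fgliftZ.
rewrite formal_mulDr formal_mulZr; congr (c *: _ + _); last exact: IHv.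
rewrite formal_mulUU !fgliftU formal_mulUU; congr << _ >>.
by apply/ffunP => k; rewrite !ffunE.
Qed.

Lemma tensor_perm_map s a : tensor_perm s (tensor_map a) = tensor_map a.
Proof.
rewrite -tensor_pi_perm [formal_perm _ _]fgliftZ fgliftU.
by congr (tensor_pi (a *: << _ >>)); apply/ffunP => k; rewrite !ffunE.
Qed.

Lemma tensor_permB s t r : tensor_perm s (t - r) = tensor_perm s t - tensor_perm s r.
Proof.
rewrite -[t]tensor_reprK -[r]tensor_reprK -raddfB -!tensor_pi_perm.
by rewrite [formal_perm s (_ - _)]fgliftB raddfB.
Qed.

Lemma tensor_permM s (t r : tensor_power) :
  tensor_perm s (t * r) = tensor_perm s t * tensor_perm s r.
Proof.
rewrite -[t]tensor_reprK -[r]tensor_reprK.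
rewrite -[X in tensor_perm s X]tensor_piM -!tensor_pi_perm formal_permM.
exact: tensor_piM.
Qed.

Definition sym_tensor_pred : pred tensor_power :=
  fun t => [forall s, tensor_perm s t == t].

Lemma sym_tensorP t :
  reflect (forall s, tensor_perm s t = t) (t \in sym_tensor_pred).
Proof. exact: eqfunP. Qed.

Fact sym_tensor_subring_closed : subring_closed sym_tensor_pred.
Proof.
split=> [|t r /sym_tensorP ts /sym_tensorP rs|t r /sym_tensorP ts /sym_tensorP rs].
- by apply/sym_tensorP => s; rewrite -(rmorph1 tensor_map) tensor_perm_map.
- by apply/sym_tensorP => s; rewrite tensor_permB ts rs.
- by apply/sym_tensorP => s; rewrite tensor_permM ts rs.
Qed.

Record sym_tensor : Type :=
  SymTensor { sym_tensor_val; _ : sym_tensor_val \in sym_tensor_pred }.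

HB.instance Definition _ := [isSub for sym_tensor_val].
HB.instance Definition _ := [Choice of sym_tensor by <:].
HB.instance Definition _ := GRing.SubChoice_isSubPzRing.Build tensor_power
  sym_tensor_pred sym_tensor sym_tensor_subring_closed.

Fact sym_tensor_map_subproof a : tensor_map a \in sym_tensor_pred.
Proof. by apply/sym_tensorP => s; apply: tensor_perm_map. Qed.

Definition sym_tensor_map (a : A) : sym_tensor :=
  SymTensor (sym_tensor_map_subproof a).

Fact sym_tensor_map_zmod_morphism : zmod_morphism sym_tensor_map.
Proof. by move=> a b; apply: val_inj; rewrite !raddfB /= raddfB. Qed.

Fact sym_tensor_map_monoid_morphism : monoid_morphism sym_tensor_map.
Proof.
split; first by apply: val_inj; rewrite rmorph1 /= rmorph1.
by move=> a b; apply: val_inj; rewrite rmorphM /= rmorphM.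
Qed.

HB.instance Definition _ :=
  GRing.isZmodMorphism.Build A sym_tensor sym_tensor_map
    sym_tensor_map_zmod_morphism.
HB.instance Definition _ :=
  GRing.isMonoidMorphism.Build A sym_tensor sym_tensor_map
    sym_tensor_map_monoid_morphism.

Fact sym_tensor_central a (t : sym_tensor) :
  sym_tensor_map a * t = t * sym_tensor_map a.
Proof. by apply: val_inj; rewrite !rmorphM /= tensor_central. Qed.

Definition sym_tensor_alg : algebra A := Algebra sym_tensor_central.

End TensorPower.

Section Invariants.
Variables (K : fieldType) (n : nat).

(* K[gl_n]; the coordinate y_ij is the variable of index [mxvec_index i j]. *)
Local Notation S := {mpoly K[n * n]}.

Definition generic_mx : 'M[S]_n := \matrix_(i, j) 'X_(mxvec_index i j).

Definition dcoord (i j : 'I_n) (p : S) : S := p^`M(mxvec_index i j).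

Definition eval_at (Y : 'M[K]_n) (p : S) : K := p.@[mxvec Y 0].

Definition const_mpoly (c : K) : S := c%:MP.

Definition char_coef (k : nat) : S :=
  \sum_(I : {set 'I_n} | #|I| == k)
    \det (mxsub (fun i : 'I_#|I| => enum_val i) (fun j : 'I_#|I| => enum_val j)
             generic_mx).

(* The derivative of p along the vector field Y |-> [X, Y]: up to sign, the
   action of X on S(gl_n^* ) that extends the coadjoint action.  Its common
   kernel for all X, the type [gl_invariant] below, is S(gl_n^* )^gl_n. *)
Definition ad_action (X : 'M[K]_n) (p : S) : S :=
  let X' := map_mx const_mpoly X in
  let V := X' *m generic_mx - generic_mx *m X' in
  \sum_i \sum_j V i j * dcoord i j p.

Definition gl_invariant_pred : pred S := fun p => `[< forall X, ad_action X p = 0 >].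

Lemma gl_invariantP p :
  reflect (forall X, ad_action X p = 0) (p \in gl_invariant_pred).
Proof. exact: asboolP. Qed.

Fact gl_invariant_subring_closed : subring_closed gl_invariant_pred.
Proof.
split=> [|p q /gl_invariantP p0 /gl_invariantP q0|
          p q /gl_invariantP p0 /gl_invariantP q0];
  apply/gl_invariantP => X.
- apply: big1 => i _; apply: big1 => j _.
  by rewrite /dcoord -mpolyC1 mderivC mulr0.
- rewrite -[RHS](subrr 0) -{1}(p0 X) -(q0 X) -sumrB; apply: eq_bigr => i _.
  by rewrite -sumrB; apply: eq_bigr => j _; rewrite -mulrBr /dcoord linearB.
- have -> : 0 = ad_action X p * q + p * ad_action X q :> S.
    by rewrite p0 q0 mul0r mulr0 addr0.
  rewrite /ad_action mulr_suml mulr_sumr -big_split; apply: eq_bigr => i _ /=.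
  rewrite mulr_suml mulr_sumr -big_split; apply: eq_bigr => j _ /=.
  by rewrite /dcoord mderivM mulrDr !mulrA [p * _]mulrC.
Qed.

Record gl_invariant : Type :=
  GlInvariant { gl_invariant_val; _ : gl_invariant_val \in gl_invariant_pred }.

HB.instance Definition _ := [isSub for gl_invariant_val].
HB.instance Definition _ := [Choice of gl_invariant by <:].
HB.instance Definition _ := GRing.SubChoice_isSubComNzRing.Build S
  gl_invariant_pred gl_invariant gl_invariant_subring_closed.

End Invariants.

(* The matrices, in a basis of a representation of GL_n, of the action of g and
   of the associated action of X in gl_n.  The laws of a representation are not
   part of the record: it is only used at [vector_rep] and [sym_rep] below. *)
Record rep_data (K : fieldType) (n : nat) := RepData {
  rep_dim : nat;
  rep_act : 'M[K]_n -> 'M[K]_rep_dim;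
  rep_diff : 'M[K]_n -> 'M[K]_rep_dim
}.

Section BigAlgebra.
Variables (K : fieldType) (n : nat) (V : rep_data K n).

Local Notation S := {mpoly K[n * n]}.
(* S(gl_n^* ) ⊗ End V, as the matrices over S. *)
Local Notation SEnd := 'M[S]_(rep_dim V).

Definition equivariant (F : SEnd) : Prop :=
  forall g Y : 'M[K]_n, g \in unitmx ->
    map_mx (eval_at (g *m Y *m invmx g)) F
      = rep_act V g *m map_mx (eval_at Y) F *m rep_act V (invmx g).

Definition kirillov_wei (F : SEnd) : SEnd :=
  \sum_i \sum_j
    map_mx (dcoord j i) F *m map_mx (@const_mpoly K n) (rep_diff V (delta_mx i j)).

Definition invariant_subalgebra (P : SEnd -> Prop) : Prop :=
  [/\ forall a : gl_invariant K n, P (val a)%:M,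
      forall F G, P F -> P G -> P (F + G)
    & forall F G, P F -> P G -> P (F *m G)].

(* The intersection of the S(gl_n^* )^gl_n-subalgebras of the Kirillov algebra
   that contain the D^q(c_(p+q)). *)
Definition big_pred : pred SEnd := fun F =>
  `[< forall P : SEnd -> Prop,
        invariant_subalgebra P ->
        (forall G, P G -> equivariant G) ->
        (forall p q : nat, (p + q <= n)%N ->
           P (iter q kirillov_wei (char_coef K n (p + q))%:M)) ->
        P F >].

Fact big_subring_closed : subring_closed big_pred.
Proof.
split=> [|F G /asboolP bF /asboolP bG|F G /asboolP bF /asboolP bG];
  apply/asboolP => P subP eqvP genP; have [PA PD PM] := subP.
- exact: (PA 1).
- rewrite -mulN1r; apply: PD; first exact: bF.
  have PN1 : P (-1) by have := PA (-1); rewrite !raddfN.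
  by apply: PM; [exact: PN1 | exact: bG].
- by apply: PM; [exact: bF | exact: bG].
Qed.

Record big_carrier : Type := BigCarrier { big_val; _ : big_val \in big_pred }.

HB.instance Definition _ := [isSub for big_val].
HB.instance Definition _ := [Choice of big_carrier by <:].
HB.instance Definition _ := GRing.SubChoice_isSubPzRing.Build SEnd
  big_pred big_carrier big_subring_closed.

Fact big_map_subproof (a : gl_invariant K n) : (val a)%:M \in big_pred.
Proof. by apply/asboolP => P [PA _ _] _ _; exact: PA. Qed.

Definition big_map (a : gl_invariant K n) : big_carrier :=
  BigCarrier (big_map_subproof a).

Fact big_map_zmod_morphism : zmod_morphism big_map.
Proof. by move=> a b; apply: val_inj; rewrite raddfB /= !raddfB. Qed.

Fact big_map_monoid_morphism : monoid_morphism big_map.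
Proof.
split; first by apply: val_inj.
by move=> a b; apply: val_inj; rewrite rmorphM /=; exact: scalar_mxM.
Qed.

HB.instance Definition _ :=
  GRing.isZmodMorphism.Build (gl_invariant K n) big_carrier big_map
    big_map_zmod_morphism.
HB.instance Definition _ :=
  GRing.isMonoidMorphism.Build (gl_invariant K n) big_carrier big_map
    big_map_monoid_morphism.

Fact big_central a (F : big_carrier) : big_map a * F = F * big_map a.
Proof. by apply: val_inj; rewrite !rmorphM /=; exact: comm_scalar_mx. Qed.

Definition big_algebra : algebra (gl_invariant K n) := Algebra big_central.

End BigAlgebra.

Definition vector_rep (K : fieldType) (n : nat) : rep_data K n :=
  RepData (fun g => g) (fun X => X).

(* S^m(K^n) is the space of homogeneous polynomials of degree m in the standard
   basis 'X_0, ..., 'X_(n-1) of K^n.  Operators are written in its basis of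
   monomials, acting on column vectors. *)
Section SymmetricPower.
Variables (K : fieldType) (n m : nat).

Local Notation P := {mpoly K[n]}.

Definition monomials : {set 'X_{1..n < m.+1}} := [set a : 'X_{1..n < m.+1} | mdeg a == m].

Definition monomial (i : 'I_#|monomials|) : 'X_{1..n} :=
  let a : 'X_{1..n < m.+1} := enum_val i in a.

Definition op_mx (T : P -> P) : 'M[K]_#|monomials| :=
  \matrix_(i, j) (T 'X_[monomial j])@_(monomial i).

(* The algebra endomorphism, resp. the derivation, of Sym(K^n) that extends the
   linear map of matrix g, resp. X, so that E_ij acts by 'X_i * d/d'X_j. *)
Definition sym_subst (g : 'M[K]_n) (p : P) : P :=
  p \mPo [tuple \sum_i g i j *: 'X_i | j < n].
Definition sym_deriv (X : 'M[K]_n) (p : P) : P :=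
  \sum_j (\sum_i X i j *: 'X_i) * p^`M(j).

Definition sym_rep : rep_data K n :=
  RepData (fun g => op_mx (sym_subst g)) (fun X => op_mx (sym_deriv X)).

End SymmetricPower.

(* Main.v *)
From HB Require Import structures.
Require Import Defs.
From mathcomp Require Import all_boot all_order all_algebra.
From mathcomp Require Import reals complex.
From mathcomp Require Import perm boolp mpoly freeg separable ring zify.

(* Write pi for the differential of the representation and G_k for the gradient
   of c_k. On S^m(C^n), the product E_kl E_ij is a normally ordered term
   symmetric in k and i, plus d_li E_kj; since second derivatives of c_k are
   alternating in these indices, only the contraction survives, and
   D^2(c_(k+1)) = - (n - k) D(c_k). Hence B(m varpi_1) is generated over the
   invariants by the D(c_k) = pi(G_k), equivalently by the pi(Y^k), because
   G_(k+1) = c_k - Y G_k. In particular B(varpi_1) is spanned by the powers of Y.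
   At a diagonal matrix with entries d_1, ..., d_n, pi(Y^k) acts on the monomial
   x_(f 1) ... x_(f m) by the power sum of the d_(f l)^k, which is also the value
   at (d_(f 1), ..., d_(f m)) of the power sum tensor of Y^k. Values at diagonal
   matrices with distinct entries determine both equivariant maps (these
   matrices have dense conjugacy classes) and tensors (Vandermonde), and power
   sums generate the symmetric tensors, so both algebras are identified with
   the same algebra of functions. *)

Set Implicit Arguments.
Unset Strict Implicit.
Unset Printing Implicit Defensive.

Import GRing.Theory Num.Theory.
Local Open Scope ring_scope.

(** * Polynomial functions *)

(** The invariants are defined through the Lie algebra but equivariance through the group, and
    [big_pred] quantifies only over subalgebras of equivariant maps, so it says nothing until one
    containing the generators is known. Hence the passage from infinitesimal to group invariance,
    done algebraically: the segment from 1 to g replaces the exponential, and along it an invariant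
    satisfies a linear differential equation with polynomial coefficients. The factor n - k and the
    alternation of second derivatives both come from det(X + Y), with X a scalar variable; the
    factor expresses that X + Y is unchanged when a scalar is moved from X to Y. Cayley-Hamilton
    leaves only 1, Y, ..., Y^(n-1), which makes the Vandermonde matrices square. The isomorphism is
    not given by a formula: it is the relation of having the same values at diagonal matrices, shown
    to be total and single-valued in both directions, so that neither algebra needs a
    presentation. *)

Lemma mpoly_ring_ind (R : comNzRingType) (n : nat) (P : {mpoly R[n]} -> Prop) :
    (forall c, P c%:MP) -> (forall i, P 'X_i) ->
    (forall p q, P p -> P q -> P (p + q)) ->
    (forall p q, P p -> P q -> P (p * q)) ->
  forall p, P p.
Proof.
move=> PC PX PD PM; elim/mpolyind => [|c m p _ _ Pp]; first by rewrite -mpolyC0.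
apply: PD => //; rewrite -mul_mpolyC mpolyXE_id; apply: (PM) => //.
elim/big_ind: _ => [|x y|i _]; [by rewrite -mpolyC1|exact: PM|].
elim: (m i) => [|k IHk]; first by rewrite expr0 -mpolyC1.
by rewrite exprS; apply: PM.
Qed.

Lemma mderivXU (R : nzRingType) (n : nat) (i j : 'I_n) :
  'X_i^`M(j) = (i == j)%:R :> {mpoly R[n]}.
Proof.
rewrite mderivX mnm1E; have [->|] := eqVneq; last by rewrite scale0r.
rewrite scale1r (_ : U_(j) - U_(j) = 0)%MM ?mpolyX0 //.
by apply/mnmP => k; rewrite mnmBE subnn mnm0E.
Qed.

Lemma mmap_chain (R B : comNzRingType) (n : nat) (f : {rmorphism R -> B})
    (h : 'I_n -> B) (d : {additive B -> B}) (p : {mpoly R[n]}) :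
    (forall x y, d (x * y) = d x * y + x * d y) -> (forall c, d (f c) = 0) ->
  d (mmap f h p) = \sum_i d (h i) * mmap f h p^`M(i).
Proof.
move=> dM dC; elim/mpoly_ring_ind: p => [c|j|p q IHp IHq|p q IHp IHq].
- by rewrite mmapC dC big1 // => i _; rewrite mderivC mmap0 mulr0.
- rewrite mmapX mmap1U (bigD1 j) //= big1 ?addr0 => [|i ij]; rewrite mderivXU.
    by rewrite eqxx rmorph1 mulr1.
  by rewrite eq_sym (negbTE ij) rmorph0 mulr0.
- rewrite mmapD raddfD IHp IHq -big_split; apply: eq_bigr => i _ /=.
  by rewrite mderivD mmapD mulrDr.
- rewrite rmorphM dM IHp IHq mulr_suml mulr_sumr -big_split.
  apply: eq_bigr => i _ /=; rewrite mderivM mmapD !rmorphM /=; ring.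
Qed.

Lemma deriv_mmap (K : comNzRingType) (n : nat) (h : 'I_n -> {poly K}) (p : {mpoly K[n]}) :
  (mmap polyC h p)^`() = \sum_i (h i)^`() * mmap polyC h p^`M(i).
Proof.
apply: (mmap_chain (f := polyC) h (d := deriv)) => [x y|c]; first exact: derivM.
exact: derivC.
Qed.

Lemma horner_mmap (K : comNzRingType) (n : nat) (h : 'I_n -> {poly K}) (p : {mpoly K[n]}) x :
  (mmap polyC h p).[x] = p.@[fun i => (h i).[x]].
Proof.
elim/mpoly_ring_ind: p => [c|j|p q IHp IHq|p q IHp IHq].
- by rewrite mmapC mevalC hornerC.
- by rewrite mmapX mmap1U mevalXU.
- by rewrite mmapD hornerD IHp IHq mevalD.
- by rewrite rmorphM /= hornerM IHp IHq mevalM.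
Qed.

Lemma poly_eq0_eval (K : numFieldType) (p : {poly K}) : (forall x, p.[x] = 0) -> p = 0.
Proof.
move=> p0; apply/eqP/negPn/negP => /(max_poly_roots (rs := [seq i%:R | i <- iota 0 (size p)])).
rewrite map_inj_uniq ?iota_uniq => [|i j /eqP]; last by rewrite eqr_nat => /eqP.
by rewrite size_map size_iota ltnn => /(_ _ isT); apply/implyP/allP => x; rewrite /root p0 eqxx.
Qed.

(** By induction on the size: p vanishes along every coordinate line, so its partial derivatives
    vanish as functions and are 0 by induction; in characteristic 0 only a constant is left. *)
Lemma mpoly_eq0_eval (K : numFieldType) (n : nat) (p : {mpoly K[n]}) :
  (forall v, p.@[v] = 0) -> p = 0.
Proof.
elim: {p}_.+1 {-2}p (ltnSn (msize p)) => // s IHs p; rewrite ltnS => sp p0.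
have dp0 i : p^`M(i) = 0.
  have [-> |dpn0] := eqVneq p^`M(i) 0; first by [].
  apply: IHs => [|v].
    apply: leq_trans sp; rewrite -(mlead_deg dpn0).
    have : mlead p^`M(i) \in msupp p^`M(i) by apply: mlead_supp.
    rewrite mcoeff_msupp mcoeff_mderiv => cn0.
    have /msize_mdeg_lt : (mlead p^`M(i) + U_(i))%MM \in msupp p.
      by rewrite mcoeff_msupp; apply: contraNneq cn0 => ->; rewrite mul0rn.
    by rewrite mdegD mdeg1 addn1.
  pose h j : {poly K} := (v j)%:P + (j == i)%:R *: 'X.
  have h0 : mmap polyC h p = 0 by apply: poly_eq0_eval => x; rewrite horner_mmap p0.
  have := congr1 (fun q => q^`().[0]) h0; rewrite deriv_mmap derivC horner0 horner_sum.
  rewrite (bigD1 i) //= big1 ?addr0 => [|j ji].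
    rewrite hornerM horner_mmap /h derivD derivC derivZ derivX eqxx scale1r add0r hornerC mul1r.
    move=> <-; apply: meval_eq => j.
    by rewrite hornerD hornerC hornerZ hornerX mulr0 addr0.
  by rewrite /h derivD derivC derivZ (negbTE ji) scale0r add0r mul0r horner0.
have pC m : m != 0%MM -> p@_m = 0.
  move=> m0; have [i mi] : exists i, m i != 0%N.
    apply/existsP; apply: contraNT m0; rewrite negb_exists => /forallP m0.
    by apply/eqP/mnmP => i; rewrite mnm0E; apply/eqP/negPn/m0.
  have := congr1 (fun q => q@_(m - U_(i))) (dp0 i).
  rewrite mcoeff_mderiv mcoeff0 submK; last by rewrite lep1mP.
  by move/eqP; rewrite mulrn_eq0 => /orP[//|/eqP].
have pE : p = (p@_0%MM)%:MP.
  by apply/mpolyP => m; rewrite mcoeffC; case: eqVneq => [->|/pC ->]; rewrite ?mulr1 ?mulr0.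
by have := p0 (fun _ => 0); rewrite pE mevalC => ->; rewrite mpolyC0.
Qed.

(** * The symmetric powers as representations *)

Section MonomialBasis.
Variables (K : fieldType) (n m : nat).
Local Notation P := {mpoly K[n]}.

Lemma mdeg_monomial (i : 'I_#|monomials n m|) : mdeg (monomial i) = m.
Proof. by have := enum_valP i; rewrite inE => /eqP. Qed.

Lemma monomial_inj : injective (@monomial n m).
Proof. by move=> i j /val_inj/enum_val_inj. Qed.

Lemma monomial_surj (a : 'X_{1..n}) :
  mdeg a = m -> exists i : 'I_#|monomials n m|, monomial i = a.
Proof.
move=> am; have lt_a : (mdeg a < m.+1)%N by rewrite am.
have aM : BMultinom lt_a \in monomials n m by rewrite inE /= am.
by exists (enum_rank_in aM (BMultinom lt_a)); rewrite /monomial enum_rankK_in.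
Qed.

Lemma dhomog_monomialE (p : P) : p \is m.-homog ->
  p = \sum_(k < #|monomials n m|) p@_(monomial k) *: 'X_[monomial k].
Proof.
move=> hp; apply/mpolyP => a; rewrite (raddf_sum (mcoeff a)) /=.
have [/monomial_surj[i <-]|am] := eqVneq (mdeg a) m.
  rewrite (bigD1 i) //= big1 => [|k ki]; rewrite mcoeffZ mcoeffX.
    by rewrite eqxx mulr1 addr0.
  by rewrite (inj_eq monomial_inj) (negbTE ki) mulr0.
rewrite (dhomog_nemf_coeff hp am) big1 // => k _; rewrite mcoeffZ mcoeffX.
by case: eqP => [ka|_]; rewrite ?mulr0 //; rewrite -ka mdeg_monomial eqxx in am.
Qed.

(** T' has to preserve degree m: otherwise the monomials outside the basis would be lost between the
    two matrices. *)
Lemma op_mxM (T : {linear P -> P}) (T' : P -> P) :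
    (forall a, mdeg a = m -> T' 'X_[a] \is m.-homog) ->
  op_mx m T *m op_mx m T' = op_mx m (T \o T').
Proof.
move=> hT'; apply/matrixP => i j; rewrite !mxE /=.
rewrite [in RHS](dhomog_monomialE (hT' _ (mdeg_monomial j))) linear_sum raddf_sum /=.
by apply: eq_bigr => k _; rewrite !mxE linearZ mcoeffZ mulrC.
Qed.

Lemma eq_op_mx (T T' : P -> P) : T =1 T' -> op_mx m T = op_mx m T'.
Proof. by move=> eqT; apply/matrixP => i j; rewrite !mxE eqT. Qed.

Fact sym_subst_linear (g : 'M[K]_n) : linear (sym_subst g).
Proof. by move=> a p q; rewrite /sym_subst linearP. Qed.

HB.instance Definition _ g :=
  GRing.isLinear.Build K P P _ (sym_subst g) (sym_subst_linear g).

Fact sym_subst_monoid_morphism (g : 'M[K]_n) : monoid_morphism (sym_subst g).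
Proof. by split=> [|p q]; rewrite /sym_subst ?rmorph1 ?rmorphM. Qed.

HB.instance Definition _ g :=
  GRing.isMonoidMorphism.Build P P (sym_subst g) (sym_subst_monoid_morphism g).

Lemma sym_substM (g : 'M[K]_n) : {morph sym_subst g : p q / p * q}.
Proof. exact: rmorphM. Qed.

Fact sym_deriv_linear (X : 'M[K]_n) : linear (sym_deriv X).
Proof.
move=> a p q; rewrite /sym_deriv scaler_sumr -big_split; apply: eq_bigr => j _ /=.
by rewrite linearP mulrDr scalerAr.
Qed.

HB.instance Definition _ X :=
  GRing.isLinear.Build K P P _ (sym_deriv X) (sym_deriv_linear X).

Lemma sym_derivM (X : 'M[K]_n) p q : sym_deriv X (p * q) = sym_deriv X p * q + p * sym_deriv X q.
Proof.
rewrite /sym_deriv mulr_suml mulr_sumr -big_split; apply: eq_bigr => j _ /=.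
by rewrite mderivM; ring.
Qed.

Lemma sym_derivC (X : 'M[K]_n) c : sym_deriv X c%:MP = 0.
Proof. by rewrite /sym_deriv big1 // => j _; rewrite mderivC mulr0. Qed.

Lemma sym_derivXU (X : 'M[K]_n) j : sym_deriv X 'X_j = \sum_i X i j *: 'X_i :> P.
Proof.
rewrite /sym_deriv (bigD1 j) //= [X in _ + X]big1 ?addr0 => [|k kj]; rewrite mderivXU.
  by rewrite eqxx mulr1.
by rewrite eq_sym (negbTE kj) mulr0.
Qed.

Lemma sym_substC (g : 'M[K]_n) c : sym_subst g c%:MP = c%:MP :> P.
Proof. exact: comp_mpolyC. Qed.

Lemma sym_substXU (g : 'M[K]_n) j : sym_subst g 'X_j = \sum_i g i j *: 'X_i :> P.
Proof. by rewrite /sym_subst comp_mpolyXU -tnth_nth tnth_mktuple. Qed.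

Lemma sym_subst_comp (g h : 'M[K]_n) p : sym_subst g (sym_subst h p) = sym_subst (g *m h) p.
Proof.
elim/mpoly_ring_ind: p => [c|j|p q IHp IHq|p q IHp IHq].
- by rewrite !sym_substC.
- rewrite !sym_substXU linear_sum.
  under eq_bigr => i _ do rewrite linearZ /= sym_substXU scaler_sumr.
  rewrite exchange_big; apply: eq_bigr => i _; rewrite mxE scaler_suml.
  by apply: eq_bigr => k _; rewrite scalerA mulrC.
- by rewrite !raddfD /= IHp IHq.
- by rewrite !rmorphM /= IHp IHq.
Qed.

Lemma sym_subst1 (p : P) : sym_subst 1%:M p = p.
Proof.
elim/mpoly_ring_ind: p => [c|j|p q IHp IHq|p q IHp IHq].
- by rewrite sym_substC.
- rewrite sym_substXU (bigD1 j) //= big1 => [|i ij]; rewrite !mxE.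
    by rewrite eqxx scale1r addr0.
  by rewrite (negbTE ij) scale0r.
- by rewrite raddfD /= IHp IHq.
- by rewrite rmorphM /= IHp IHq.
Qed.

(** Both sides are derivations relative to [sym_subst g], so it suffices to compare them on the
    variables, where the claim is the hypothesis on matrices. *)
Lemma sym_subst_deriv (g X Z : 'M[K]_n) p : Z *m g = g *m X ->
  sym_subst g (sym_deriv X p) = sym_deriv Z (sym_subst g p).
Proof.
move=> ZgX; elim/mpoly_ring_ind: p => [c|j|p q IHp IHq|p q IHp IHq].
- by rewrite sym_substC !sym_derivC raddf0.
- have E (h k : 'M[K]_n) (T : {linear P -> P}) :
      (forall i, T 'X_i = \sum_l h l i *: 'X_l) ->
    T (\sum_i k i j *: 'X_i) = \sum_l (h *m k) l j *: 'X_l.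
    move=> TX; rewrite linear_sum.
    under eq_bigr => i _ do rewrite linearZ /= TX scaler_sumr.
    rewrite exchange_big; apply: eq_bigr => l _; rewrite mxE scaler_suml.
    by apply: eq_bigr => i _; rewrite scalerA mulrC.
  rewrite sym_derivXU sym_substXU (E g); last exact: sym_substXU.
  by rewrite (E Z) ?ZgX //; exact: sym_derivXU.
- by rewrite !raddfD /= IHp IHq.
- by rewrite sym_derivM [LHS]raddfD /= !sym_substM sym_derivM IHp IHq.
Qed.

Lemma dhomog_linear_form (c : 'I_n -> K) : \sum_i c i *: 'X_i \is [in K[n], 1.-homog].
Proof. by apply: rpred_sum => i _; apply: rpredZ; rewrite dhomogX /= mdeg1. Qed.

Lemma sym_subst_dhomog (g : 'M[K]_n) a : mdeg a = m -> sym_subst g 'X_[a] \is m.-homog.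
Proof.
move=> <-; rewrite /sym_subst comp_mpolyX mdegE.
apply: (big_rec2 (fun d (p : P) => p \is d.-homog)) => [|i d p _ hp]; first exact: dhomog1.
apply: dhomogM => //; rewrite -[X in X.-homog]mul1n; apply: dhomogMn.
by rewrite tnth_mktuple; apply: dhomog_linear_form.
Qed.

Lemma sym_deriv_dhomog (X : 'M[K]_n) a : mdeg a = m -> sym_deriv X 'X_[a] \is m.-homog.
Proof.
move=> am; apply: rpred_sum => j _; rewrite mderivX -scalerAr.
have [->|aj] := eqVneq (a j) 0%N; first by rewrite scale0r rpred0.
apply: rpredZ; have le_ja : (U_(j) <= a)%MM by rewrite lep1mP.
rewrite (_ : m = 1 + mdeg (a - U_(j))%MM)%N; last first.
  by rewrite -am -{1}(submK le_ja) mdegD mdeg1 addnC.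
by apply: dhomogM; [apply: dhomog_linear_form|rewrite dhomogX].
Qed.

End MonomialBasis.

(** The laws left out of [rep_data] that the vector representation and the symmetric powers share;
    the generators of both big algebras are computed from them at once. *)
Record good_rep (K : fieldType) (n : nat) (V : rep_data K n) : Prop := GoodRep {
  rep_diff_linear : forall a X Y,
    rep_diff V (a *: X + Y) = a *: rep_diff V X + rep_diff V Y;
  (* In the vector representation both sides are 0, and in a symmetric power
     they are 'X_i 'X_k d/d'X_l d/d'X_j: the normally ordered part of the
     product E_kl E_ij is symmetric in the two row indices. *)
  rep_diff_order : forall i j k l,
    rep_diff V (delta_mx k l) *m rep_diff V (delta_mx i j)
        - (l == i)%:R *: rep_diff V (delta_mx k j)
      = rep_diff V (delta_mx i l) *m rep_diff V (delta_mx k j)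
        - (l == k)%:R *: rep_diff V (delta_mx i j);
  rep_actV : forall g, g \in unitmx -> rep_act V g *m rep_act V (invmx g) = 1%:M;
  rep_diff_conj : forall g X, g \in unitmx ->
    rep_act V g *m rep_diff V X *m rep_act V (invmx g)
      = rep_diff V (g *m X *m invmx g)
}.

Lemma vector_good_rep (K : fieldType) (n : nat) : good_rep (vector_rep K n).
Proof.
split=> //= [i j k l|g gU]; last exact: mulmxV.
by rewrite !mul_delta_mx_cond !scaler_nat !subrr.
Qed.

Lemma sym_good_rep (K : fieldType) (n m : nat) : good_rep (sym_rep K n m).
Proof.
split=> /= [a X Y|i j k l|g gU|g X gU].
- apply/matrixP => s t; rewrite !mxE -mcoeffZ -mcoeffD; congr mcoeff.
  rewrite /sym_deriv scaler_sumr -big_split; apply: eq_bigr => j _ /=.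
  rewrite scalerAl -mulrDl scaler_sumr -big_split; congr (_ * _).
  by apply: eq_bigr => i _ /=; rewrite !mxE scalerDl scalerA.
- have dE a b (p : {mpoly K[n]}) : sym_deriv (delta_mx a b) p = 'X_a * p^`M(b).
    rewrite /sym_deriv (bigD1 b) //= [X in _ + X]big1 ?addr0 => [|c cb].
      rewrite (bigD1 a) //= big1 ?addr0 => [|c ca]; first by rewrite mxE !eqxx scale1r.
      by rewrite mxE (negbTE ca) scale0r.
    by rewrite big1 ?mul0r // => d _; rewrite mxE (negbTE cb) andbF scale0r.
  do 2!(rewrite op_mxM; last by move=> a; apply: sym_deriv_dhomog).
  apply/matrixP => s t; rewrite !mxE -!mcoeffZ -!mcoeffB; congr mcoeff => /=.
  rewrite !dE !mderivM !mderivXU ![l == _]eq_sym !scaler_nat.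
  by do 2!case: eqP => _ /=; rewrite ?mulr1n ?mulr0n; ring.
- rewrite op_mxM; last by move=> a; apply: sym_subst_dhomog.
  apply/matrixP => s t; rewrite !mxE /= sym_subst_comp mulmxV // sym_subst1 mcoeffX.
  by rewrite (inj_eq (@monomial_inj _ _)) eq_sym.
- rewrite -mulmxA op_mxM; last by move=> a; apply: sym_subst_dhomog.
  rewrite op_mxM => [|a am].
    apply: eq_op_mx => p /=; rewrite (sym_subst_deriv (Z := g *m X *m invmx g)).
      by rewrite sym_subst_comp mulmxV // sym_subst1.
    by rewrite mulmxKV.
  rewrite /= (dhomog_monomialE (sym_subst_dhomog _ am)) linear_sum.
  apply: rpred_sum => k _; rewrite linearZ /=; apply: rpredZ.
  by apply: sym_deriv_dhomog; apply: mdeg_monomial.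
Qed.

(** * The coefficients c_k and their gradients *)

Lemma det_mxsub_inj (R : comNzRingType) (k n : nat) (f : 'I_k -> 'I_n) (A : 'M[R]_n) :
  k = n -> injective f -> \det (mxsub f f A) = \det A.
Proof.
move=> kn f_inj; rewrite {k}kn in f f_inj *.
have -> : mxsub f f A = row_perm (perm f_inj) (col_perm (perm f_inj) A).
  by apply/matrixP => i j; rewrite !mxE !permE.
rewrite row_permE col_permE !det_mulmx !det_perm odd_permV mulrCA.
by rewrite -signr_addb addbb mulr1.
Qed.

(** Multilinearity in the rows: I is the set of rows taken from A, the others come from t. Listing I
    before its complement makes [B I] block triangular, with a principal submatrix of A and a scalar
    matrix on the diagonal. *)
Lemma det_scalar_addmx (R : comNzRingType) (n : nat) (t : R) (A : 'M[R]_n) :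
  \det (t%:M + A) =
    \sum_(I : {set 'I_n}) t ^+ (n - #|I|) *
      \det (mxsub (fun i : 'I_#|I| => enum_val i) (fun j : 'I_#|I| => enum_val j) A).
Proof.
pose B (I : {set 'I_n}) := \matrix_(i, j) (if i \in I then A i j else t *+ (i == j)).
transitivity (\sum_I \det (B I)).
  rewrite exchange_big; apply: eq_bigr => s _ /=; rewrite -mulr_sumr; congr (_ * _).
  under eq_bigr => i _ do rewrite !mxE addrC.
  rewrite bigA_distr; apply: eq_bigr => I _.
  by apply: eq_bigr => i _; rewrite mxE.
apply: eq_bigr => I _; have cardI := cardsC I; rewrite card_ord in cardI.
pose f (u : 'I_(#|I| + #|~: I|)) : 'I_n :=
  match split u with inl i => enum_val i | inr j => enum_val j end.
have f_inj : injective f.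
  move=> u v; rewrite -(splitK u) -(splitK v) /f !unsplitK.
  case: (split u) (split v) => i [] j /=.
  - by move/enum_val_inj->.
  - by move=> e; have := enum_valP j; rewrite -e inE enum_valP.
  - by move=> e; have := enum_valP i; rewrite e inE enum_valP.
  - by move/enum_val_inj->.
rewrite -(det_mxsub_inj (B I) cardI f_inj).
set A' := mxsub _ _ A.
have -> : mxsub f f (B I) =
    block_mx A' (\matrix_(i, j) A (enum_val i) (enum_val j)) 0 t%:M.
  apply/matrixP => u v; rewrite -(splitK u) -(splitK v) [LHS]mxE [LHS]mxE /f !unsplitK.
  case: (split u) (split v) => i [] j /=.
  - by rewrite block_mxEul mxE enum_valP.
  - by rewrite block_mxEur mxE enum_valP.
  - rewrite block_mxEdl mxE; have := enum_valP i; rewrite inE => /negbTE iI.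
    by rewrite iI; case: eqP => // e; rewrite e enum_valP in iI.
  - rewrite block_mxEdr !mxE; have := enum_valP i; rewrite inE => /negbTE ->.
    by rewrite (inj_eq enum_val_inj).
have -> : (n - #|I| = #|~: I|)%N by lia.
by rewrite det_ublock det_scalar mulrC.
Qed.

Lemma mulmx_delta (R : nzRingType) (k l p q : nat) (U : 'M[R]_(k, l)) (W : 'M[R]_(p, q)) a b i j :
  (U *m delta_mx a b *m W) i j = U i a * W b j.
Proof.
rewrite mxE (bigD1 b) //= big1 => [|r rb].
  rewrite mxE (bigD1 a) //= big1 => [|r ra]; rewrite !mxE.
    by rewrite !eqxx mulr1 !addr0.
  by rewrite (negbTE ra) mulr0.
by rewrite mxE big1 ?mul0r // => s _; rewrite !mxE (negbTE rb) andbF mulr0.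
Qed.

(** * Derivatives of determinants and adjugates *)

Section Derivation.
Variables (B : comNzRingType) (d : {additive B -> B}).
Hypothesis dM : forall x y, d (x * y) = d x * y + x * d y.

Lemma derivation1 : d 1 = 0.
Proof. by have /eqP := dM 1 1; rewrite !mulr1 mul1r -subr_eq subrr eq_sym => /eqP. Qed.

Lemma derivation_prod0 (I : Type) (r : seq I) (P : pred I) (F : I -> B) :
  (forall i, P i -> d (F i) = 0) -> d (\prod_(i <- r | P i) F i) = 0.
Proof.
move=> dF; elim/big_ind: _ => [|x y dx dy|//]; first exact: derivation1.
by rewrite dM dx dy mul0r mulr0 addr0.
Qed.

Lemma derivation_det0 k (M : 'M[B]_k) : (forall i j, d (M i j) = 0) -> d (\det M) = 0.
Proof.
move=> dM0; rewrite raddf_sum big1 // => s _ /=.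
by rewrite -signr_odd; case: odd; rewrite ?mulN1r ?mul1r ?raddfN derivation_prod0 ?oppr0.
Qed.

(** Here d acts on M as the partial derivative in the entry (a, b). In the expansion along row a the
    cofactors do not involve that row, so d kills them. *)
Lemma derivation_det_entry k (M : 'M[B]_k) a b :
  (forall i j, d (M i j) = ((i == a) && (j == b))%:R) -> d (\det M) = (\adj M) b a.
Proof.
move=> dMab; rewrite (expand_det_row _ a) raddf_sum /= mxE.
have dcof j : d (cofactor M a j) = 0.
  rewrite /cofactor -signr_odd dM [d (\det _)]derivation_det0 ?mulr0 ?addr0 => [|i l].
    by case: odd; rewrite ?expr1 ?expr0 ?raddfN derivation1 ?oppr0 mul0r.
  by rewrite !mxE dMab eq_sym (negbTE (neq_lift _ _)).
rewrite (bigD1 b) //= big1 => [|j jb]; rewrite dM dcof mulr0 addr0 dMab.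
  by rewrite !eqxx mul1r addr0.
by rewrite (negbTE jb) andbF mul0r.
Qed.

Lemma derivation_mulmx k l p (M : 'M[B]_(k, l)) (N : 'M[B]_(l, p)) :
  map_mx d (M *m N) = map_mx d M *m N + M *m map_mx d N.
Proof.
apply/matrixP => i j; rewrite !mxE raddf_sum -big_split; apply: eq_bigr => r _ /=.
by rewrite dM !mxE.
Qed.

(** The product M adj M = det M is differentiated and multiplied on the left by adj M; the factor
    det M takes the place of an inverse of M. *)
Lemma derivation_adj k (M : 'M[B]_k) a b e c :
    (forall i j, d (M i j) = ((i == a) && (j == b))%:R) ->
  \det M * d (\adj M e c) =
    \adj M b a * \adj M e c - \adj M e a * \adj M b c.
Proof.
move=> dMab; have := congr1 (map_mx d) (mul_mx_adj M).
rewrite derivation_mulmx => /(congr1 (mulmx (\adj M))).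
rewrite mulmxDr !mulmxA mul_adj_mx => /(congr1 (fun N : 'M_k => N e c)).
have -> : map_mx d M = delta_mx a b by apply/matrixP => i j; rewrite !mxE dMab.
have -> : map_mx d ((\det M)%:M : 'M_k) = (\adj M b a)%:M.
  apply/matrixP => i j; rewrite !mxE; case: eqP => _; last by rewrite !mulr0n raddf0.
  by rewrite !mulr1n (derivation_det_entry dMab) mxE.
rewrite mul_mx_scalar mul_scalar_mx mxE mulmx_delta !mxE => <-.
by rewrite addrAC subrr add0r.
Qed.

End Derivation.

(** * The c_k as coefficients of det(X + Y) *)

Section CharCoef.
Variables (K : fieldType) (n : nat).
Local Notation S := {mpoly K[n * n]}.
Local Notation Y := (generic_mx K n).
Local Notation c := (char_coef K n).

(** Its determinant is the generating function of the c_k, so identities for all k become identities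
    for one determinant; being monic in X, that determinant can also be cancelled. *)
Definition generic_shift : 'M[{poly S}]_n := 'X%:M + map_mx polyC Y.
Local Notation N := generic_shift.

Lemma det_generic_shift : \det N = \sum_(k < n.+1) (c k)%:P * 'X^(n - k).
Proof.
rewrite det_scalar_addmx (partition_big (fun I : {set 'I_n} => inord #|I| : 'I_n.+1) predT) //=.
apply: eq_bigr => k _; rewrite rmorph_sum mulr_suml /=; apply: eq_big => [I|I].
  by rewrite -val_eqE /= inordK // ltnS -[X in (_ <= X)%N]card_ord max_card.
move=> /eqP <-; rewrite inordK ?ltnS; last by rewrite -[X in (_ <= X)%N]card_ord max_card.
by rewrite mulrC -map_mxsub det_map_mx.
Qed.

Lemma char_coefE k : (k <= n)%N -> c k = (\det N)`_(n - k).
Proof.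
move=> kn; rewrite det_generic_shift coef_sum (bigD1 (inord k)) //= big1 => [|j jk].
  by rewrite inordK // coefCM coefXn eqxx mulr1 addr0.
rewrite coefCM coefXn; case: eqP => [e|_]; rewrite ?mulr0 //.
by case/negP: jk; rewrite -val_eqE /= inordK //; have := ltn_ord j; rewrite ltnS; lia.
Qed.

Lemma char_coef0 : c 0 = 1.
Proof.
rewrite /char_coef (bigD1 set0) ?cards0 //= big1 => [|I /andP[/eqP/cards0_eq-> /eqP//]].
have det0 k (M : 'M[S]_k) : k = 0%N -> \det M = 1.
  by move=> k0; move: M; rewrite k0 => M; rewrite det_mx00.
by rewrite det0 ?cards0 ?addr0.
Qed.

Lemma char_coef_gt k : (n < k)%N -> c k = 0.
Proof.
move=> nk; rewrite /char_coef big_pred0 // => I; apply/negP => /eqP Ik.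
by have := max_card I; rewrite card_ord Ik leqNgt nk.
Qed.

Lemma det_generic_shift_neq0 : \det N != 0.
Proof.
apply/eqP => N0; have := char_coefE (leq0n n); rewrite N0 coef0 char_coef0.
by move/eqP; rewrite oner_eq0.
Qed.

Definition dpoly v (q : {poly S}) : {poly S} := map_poly (mderiv v) q.

Fact dpoly_zmod_morphism v : zmod_morphism (dpoly v).
Proof. by move=> p q; rewrite /dpoly raddfB. Qed.

HB.instance Definition _ v :=
  GRing.isZmodMorphism.Build {poly S} {poly S} (dpoly v) (dpoly_zmod_morphism v).

Lemma coef_dpoly v q k : (dpoly v q)`_k = q`_k^`M(v).
Proof. by rewrite coef_map. Qed.

Lemma dpolyM v p q : dpoly v (p * q) = dpoly v p * q + p * dpoly v q.
Proof.
apply/polyP => k; rewrite coef_dpoly coefD !coefM raddf_sum -big_split.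
by apply: eq_bigr => i _ /=; rewrite mderivM !coef_dpoly.
Qed.

Lemma dpolyX v : dpoly v 'X = 0.
Proof.
apply/polyP => k; rewrite coef_dpoly coefX coef0.
by case: eqP => _; rewrite ?raddf0 // -mpolyC1 mderivC.
Qed.

Lemma dpolyC v p : dpoly v p%:P = (p^`M(v))%:P.
Proof. exact: map_polyC. Qed.

Lemma mxvec_index_inj (i a j b : 'I_n) :
  (mxvec_index i j == mxvec_index a b) = (i == a) && (j == b).
Proof.
by rewrite [LHS](inj_eq enum_rank_inj). Qed.

Lemma dcoord_generic a b i j :
  dcoord a b (Y i j) = ((i == a) && (j == b))%:R.
Proof.
by rewrite mxE /dcoord mderivXU mxvec_index_inj.
Qed.

Lemma dpoly_shift a b i j :
  dpoly (mxvec_index a b) (N i j) = ((i == a) && (j == b))%:R.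
Proof.
rewrite mxE mxE raddfD raddfMn /= dpolyX mul0rn add0r mxE dpolyC.
by rewrite -/(dcoord a b (Y i j)) dcoord_generic rmorph_nat.
Qed.

(* d Delta/dN_cd = adj N_dc for Delta = det N; differentiating N * adj N = Delta
   once more gives Delta * d(adj N_dc)/dN_ab = adj_ba adj_dc - adj_da adj_bc,
   whose right-hand side changes sign when b and d are exchanged. *)
Lemma dcoord_char_coef_alt a b e f k :
  dcoord a b (dcoord e f (c k)) = - dcoord a f (dcoord e b (c k)).
Proof.
have [kn|/char_coef_gt->] := leqP k n; last by rewrite /dcoord !mderiv0 oppr0.
suff E : dpoly (mxvec_index a b) (dpoly (mxvec_index e f) (\det N))
    = - dpoly (mxvec_index a f) (dpoly (mxvec_index e b) (\det N)).
  by have := congr1 (fun q : {poly S} => q`_(n - k)) E; rewrite coefN !coef_dpoly -char_coefE.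
have dM v := @dpolyM v.
rewrite !(derivation_det_entry (dM _) (@dpoly_shift _ _)).
apply/eqP; rewrite -addr_eq0 -(mulrI_eq0 _ (mulfI det_generic_shift_neq0)) mulrDr.
rewrite !(derivation_adj (dM _) _ _ (@dpoly_shift _ _)); apply/eqP; ring.
Qed.

(** [D] differentiates along the shift that increases X and decreases the diagonal of Y. It kills
    every entry of X + Y, hence the determinant, and the coefficient of X^(n-k-1) in this vanishing
    is the claim. *)
Lemma dcoord_trace_char_coef k : (k < n)%N ->
  \sum_i dcoord i i (c k.+1) = (c k) *+ (n - k).
Proof.
move=> kn.
pose D (q : {poly S}) := q^`() - \sum_i dpoly (mxvec_index i i) q.
have D_add : zmod_morphism D.
  move=> p q; rewrite /D derivB; under eq_bigr => i _ do rewrite raddfB.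
  by rewrite sumrB; ring.
pose D' : {additive {poly S} -> {poly S}} :=
  HB.pack D (GRing.isZmodMorphism.Build _ _ D D_add).
have DM x y : D' (x * y) = D' x * y + x * D' y.
  rewrite /= /D derivM; under eq_bigr => i _ do rewrite dpolyM.
  by rewrite big_split /= -mulr_suml -mulr_sumr; ring.
have DN : D' (\det N) = 0.
  apply: (derivation_det0 DM) => i j.
  rewrite /= /D; under eq_bigr => r _ do rewrite dpoly_shift.
  rewrite mxE mxE derivD derivMn derivX mxE derivC addr0.
  case: eqP => [->|/eqP ij].
    rewrite (bigD1 j) //= big1 => [|r rj]; first by rewrite eqxx addr0 subrr.
    by rewrite eq_sym (negbTE rj).
  rewrite mulr0n sub0r big1 ?oppr0 // => r _.
  by case: (eqVneq i r) => // <-; rewrite eq_sym (negbTE ij).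
have := congr1 (fun q : {poly S} => q`_(n - k.+1)) DN.
rewrite /= /D coefB coef_deriv coef0 => /eqP; rewrite subr_eq0 => /eqP.
have E i : (dpoly (mxvec_index i i) (\det N))`_(n - k.+1) = dcoord i i (c k.+1).
  by rewrite coef_dpoly -char_coefE.
rewrite [X in _ = X -> _]coef_sum (eq_bigr _ (fun i _ => E i)).
by move=> <-; rewrite -subSn // subSS -char_coefE // ltnW.
Qed.

(** The gradient for the trace form: the differential of c_k at Y is Z |-> tr(Z G_k), whence the
    transposed pair of indices. *)
Definition char_grad k : 'M[S]_n := \matrix_(i, j) dcoord j i (c k).

Lemma char_grad0 : char_grad 0 = 0.
Proof. by apply/matrixP => i j; rewrite !mxE char_coef0 -mpolyC1 /dcoord mderivC. Qed.

Lemma char_gradE k i j : (k <= n)%N -> char_grad k i j = (\adj N i j)`_(n - k).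
Proof.
move=> kn; rewrite mxE -(derivation_det_entry (@dpolyM _) (dpoly_shift j i)).
by rewrite coef_dpoly -char_coefE.
Qed.

(** This is the coefficient of X^(n-k) in N adj N = det N. At k = n the left side is 0, because
    c_(n+1) = 0; this case yields the Cayley-Hamilton relation used later. *)
Lemma char_gradS k : (k <= n)%N -> char_grad k.+1 = (c k)%:M - Y *m char_grad k.
Proof.
move=> kn; apply/matrixP => i j.
have := congr1 (fun M : 'M[{poly S}]_n => (M i j)`_(n - k)) (mul_mx_adj N).
have E : ((map_mx polyC Y *m \adj N) i j)`_(n - k) = (Y *m char_grad k) i j.
  rewrite mxE coef_sum [RHS]mxE; apply: eq_bigr => l _.
  by rewrite mxE coefCM char_gradE.
have E' : ('X * \adj N i j)`_(n - k) = char_grad k.+1 i j.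
  rewrite coefXM subn_eq0; have [nk|kn'] := leqP n k; last by rewrite -subnS char_gradE.
  by rewrite mxE char_coef_gt /dcoord ?mderiv0.
rewrite /= {1}/generic_shift mulmxDl mul_scalar_mx mxE coefD E mxE E'.
rewrite [in X in _ = X -> _]mxE coefMn -char_coefE //.
by move=> e; rewrite [RHS]mxE [X in _ = X + _]mxE -e [X in _ + X]mxE addrK.
Qed.

Lemma char_grad_comm k : (k <= n)%N -> Y *m char_grad k = char_grad k *m Y.
Proof.
elim: k => [|k IHk] kn; first by rewrite char_grad0 mulmx0 mul0mx.
rewrite (char_gradS (ltnW kn)) mulmxBr mulmxBl -mulmxA -(IHk (ltnW kn)).
by rewrite mul_mx_scalar mul_scalar_mx.
Qed.

(** The derivative of c_k along [X, Y] is tr([X, Y] G_k), which vanishes because G_k commutes with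
    Y. *)
Lemma char_coef_invariant k : c k \in gl_invariant_pred (K := K) (n := n).
Proof.
apply/gl_invariantP => X; have [kn|/char_coef_gt->] := leqP k n; last first.
  by rewrite /ad_action big1 // => i _; rewrite big1 // => j _; rewrite /dcoord mderiv0 mulr0.
transitivity (\tr ((map_mx (@const_mpoly K n) X *m Y - Y *m map_mx (@const_mpoly K n) X)
                     *m char_grad k)).
  rewrite /ad_action /mxtrace; apply: eq_bigr => i _; rewrite [RHS]mxE.
  by apply: eq_bigr => j _; rewrite [char_grad k j i]mxE.
rewrite mulmxBl raddfB /= -!mulmxA char_grad_comm // [X in _ - X]mxtrace_mulC.
by rewrite -!mulmxA subrr.
Qed.

End CharCoef.

(** * From Lie algebra invariants to group invariants *)

Lemma sum_mxvec (V : nmodType) (k l : nat) (F : 'I_(k * l) -> V) :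
  \sum_v F v = \sum_i \sum_j F (mxvec_index i j).
Proof.
rewrite pair_bigA (reindex (uncurry (@mxvec_index k l))); last exact: curry_mxvec_bij.
by apply: eq_bigr => -[i j] _.
Qed.

Section Invariance.
Variables (K : numFieldType) (n : nat).
Local Notation S := {mpoly K[n * n]}.
Local Notation Y := (generic_mx K n).

Fact ad_action_linear (X : 'M[K]_n) : linear (ad_action X : S -> S).
Proof.
move=> a p q; rewrite /ad_action scaler_sumr -big_split; apply: eq_bigr => i _ /=.
rewrite scaler_sumr -big_split; apply: eq_bigr => j _ /=.
by rewrite /dcoord linearP mulrDr scalerAr.
Qed.

HB.instance Definition _ X :=
  GRing.isLinear.Build K S S _ (ad_action X) (ad_action_linear X).

Lemma ad_action_dhomog (X : 'M[K]_n) (a : 'X_{1..n * n}) :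
  ad_action X 'X_[a] \is [in K[n * n], (mdeg a).-homog].
Proof.
have YX1 i j : Y i j \is [in K[n * n], 1.-homog] by rewrite mxE dhomogX /= mdeg1.
have constM (x : K) (p : S) : @const_mpoly K n x * p = x *: p by rewrite mul_mpolyC.
apply: rpred_sum => i _; apply: rpred_sum => j _; rewrite /dcoord mderivX -scalerAr.
set v := mxvec_index i j; have [->|av] := eqVneq (a v) 0%N; first by rewrite scale0r rpred0.
apply: rpredZ; have le_va : (U_(v) <= a)%MM by rewrite lep1mP.
rewrite (_ : mdeg a = 1 + mdeg (a - U_(v))%MM)%N; last first.
  by rewrite -{1}(submK le_va) mdegD mdeg1 addnC.
apply: dhomogM; last by rewrite dhomogX.
rewrite !mxE; apply: rpredB; apply: rpred_sum => l _; rewrite [map_mx _ _ _ _]mxE.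
  by rewrite constM; apply: rpredZ.
by rewrite mulrC constM; apply: rpredZ.
Qed.

(** The vector field has linear coefficients, so it preserves degrees. Homogeneous components of an
    invariant are therefore invariant, and Euler's identity becomes available. *)
Lemma pihomog_ad_action d (X : 'M[K]_n) (p : S) :
  pihomog mdeg d (ad_action X p) = ad_action X (pihomog mdeg d p).
Proof.
rewrite [p]mpolyE (linear_sum (ad_action X)) [LHS]linear_sum (linear_sum (pihomog mdeg d)).
rewrite [RHS]linear_sum; apply: eq_bigr => a _ /=.
rewrite (linearZ_LR (ad_action X)) !(linearZ_LR (pihomog mdeg d)) (linearZ_LR (ad_action X)) /=.
rewrite pihomogX; congr (_ *: _); case: eqP => [<-|/eqP ad].
  by apply: pihomog_dE; apply: ad_action_dhomog.
by rewrite linear0; apply: pihomog_ne0 (ad_action_dhomog _ _).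
Qed.

Lemma euler_dhomog d (p : S) : p \is [in K[n * n], d.-homog] ->
  \sum_v 'X_v * p^`M(v) = p *+ d.
Proof.
move=> /dhomogP hp; rewrite [p]mpolyE.
under eq_bigr => v _ do rewrite raddf_sum mulr_sumr.
rewrite exchange_big /= -sumrMnl big_seq [RHS]big_seq; apply: eq_bigr => a /hp <-.
under eq_bigr => v _ do rewrite /= mderivZ -scalerAr mderivX -scalerAr.
rewrite -scaler_sumr scalerMnr; congr (_ *: _).
rewrite [X in _ *+ X]mdegE -sumrMnr; apply: eq_bigr => v _; rewrite scaler_nat.
have [->|av] := eqVneq (a v) 0%N; first by rewrite !mulr0n.
by rewrite -mpolyXD addmC submK // lep1mP.
Qed.

Lemma dhomog_scale d (p : S) (x : K) (h : 'I_(n * n) -> K) :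
  p \is [in K[n * n], d.-homog] -> p.@[fun v => x * h v] = x ^+ d * p.@[h].
Proof.
move=> /dhomogP hp; rewrite !mevalE mulr_sumr big_seq [RHS]big_seq.
apply: eq_bigr => a /hp <-; rewrite mulrCA; congr (_ * _).
by rewrite [X in x ^+ X]mdegE -prodrXr -big_split; apply: eq_bigr => v _; rewrite /= exprMn.
Qed.

(** Uniqueness for a linear equation that is regular at 0: the coefficient of degree k determines (k
    + 1) delta(0) D_(k+1) from the lower coefficients of D, and k + 1 is invertible. *)
Lemma poly_ode_eq0 d (delta D : {poly K}) :
    delta.[0] != 0 -> D.[0] = 0 -> delta * D^`() = delta^`() * D *+ d -> D = 0.
Proof.
move=> delta0 D0 ode; suff D0k k : forall i, (i <= k)%N -> D`_i = 0.
  by apply/polyP => k; rewrite (D0k k) ?coef0.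
elim: k => [|k IHk] i.
  by rewrite leqn0 => /eqP->; rewrite -horner_coef0.
rewrite leq_eqVlt ltnS => /orP[/eqP->|]; last exact: IHk.
have := congr1 (fun q : {poly K} => q`_k) ode; rewrite coefMn !coefM.
rewrite [X in _ = X *+ _ -> _]big1 ?mul0rn => [|j _]; last by rewrite (IHk _ (leq_subr _ _)) mulr0.
rewrite big_ord_recl big1 ?addr0 => [|j _].
  move/eqP; rewrite mulf_eq0 -horner_coef0 (negbTE delta0) /= subn0 coef_deriv.
  by rewrite mulrn_eq0 => /eqP.
by rewrite coef_deriv IHk ?mul0rn ?mulr0 // lift0 subnSK ?leq_subr.
Qed.

(** * Invariants along a segment of matrices *)

Section Path.
Variables (g Y0 : 'M[K]_n).
Let X := map_mx polyC (g - 1%:M).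
(** The segment from 1 to g. It may pass through singular matrices, so the conjugate of Y0 is
    replaced by its multiple by det G, the matrix [M], which stays polynomial. *)
Let G : 'M[{poly K}]_n := 1%:M + 'X *: X.
Let M := G *m map_mx polyC Y0 *m \adj G.
Local Notation ev := (mmap (@polyC K) (fun v => mxvec M 0 v)).

Let dG : map_mx (@deriv K) G = X.
Proof.
apply/matrixP => i j; rewrite !mxE derivD derivM derivX derivC mulr0 addr0 mul1r.
by rewrite derivMn derivC mul0rn add0r.
Qed.

(** Where G is invertible, M = det G * G Y0 G^-1 has derivative [G' G^-1, M] + (det G)'/det G * M;
    the statement is this multiplied by det G. *)
Let dM : \det G *: map_mx (@deriv K) M =
  (X *m \adj G) *m M - M *m (X *m \adj G) + (\det G)^`() *: M.
Proof.
pose dd := @derivation_mulmx _ (@deriv K : {additive _ -> _}) (@derivM K).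
have dY0 : map_mx (@deriv K) (map_mx polyC Y0) = 0.
  by apply/matrixP => i j; rewrite !mxE derivC.
have dadj : map_mx (@deriv K) (\adj G) *m G = (\det G)^`()%:M - \adj G *m X.
  have := congr1 (map_mx (@deriv K)) (mul_adj_mx G); rewrite [LHS]dd dG => e.
  apply/eqP; rewrite -[_ *m G](addrK (\adj G *m X)) e; apply/eqP; congr (_ - _).
  by apply/matrixP => i j; rewrite !mxE derivMn.
have dadj' : \det G *: map_mx (@deriv K) (\adj G) =
    (\det G)^`() *: \adj G - \adj G *m X *m \adj G.
  by rewrite -mul_mx_scalar -mul_mx_adj mulmxA dadj mulmxBl mul_scalar_mx.
rewrite /M [map_mx _ _]dd [map_mx _ (_ *m map_mx _ _)]dd dY0 mulmx0 addr0 dG scalerDr.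
rewrite [X in _ + X]scalemxAr dadj' mulmxBr -[X in _ + (X - _)]scalemxAr addrA.
rewrite [LHS]addrAC -!mulmxA (mulmxA (\adj G) G) mul_adj_mx mul_scalar_mx.
by rewrite -!scalemxAr.
Qed.

(** Invariance is assumed for matrices over K only. The expression is linear in Z over K[x], so its
    vanishing at the matrix units extends it to the matrices over K[x] that arise along the path. *)
Let ev_ad (q : S) (Z : 'M[{poly K}]_n) : q \in @gl_invariant_pred K n ->
  \sum_i \sum_j (Z *m M - M *m Z) i j * ev (dcoord i j q) = 0.
Proof.
move=> /gl_invariantP q0.
pose L (W : 'M[{poly K}]_n) := \sum_i \sum_j (W *m M - M *m W) i j * ev (dcoord i j q).
have L_delta a b : L (delta_mx a b) = 0.
  have := congr1 ev (q0 (delta_mx a b)); rewrite rmorph0 => <-.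
  rewrite /L /ad_action rmorph_sum; apply: eq_bigr => i _.
  rewrite rmorph_sum; apply: eq_bigr => j _; rewrite rmorphM; congr (_ * _).
  set V := _ *m generic_mx K n - _; transitivity ((map_mx ev V) i j); last by rewrite mxE.
  have evY : map_mx ev Y = M.
    by apply/matrixP => k l; rewrite mxE [Y k l]mxE mmapX mmap1U mxvecE.
  have evX : map_mx ev (map_mx (@const_mpoly K n) (delta_mx a b)) = delta_mx a b.
    by apply/matrixP => k l; rewrite !mxE mmapC; case: (_ && _).
  by rewrite map_mxB !map_mxM evY evX.
rewrite -/(L Z).
suff -> : L Z = \sum_a \sum_b Z a b * L (delta_mx a b).
  by rewrite big1 // => a _; rewrite big1 // => b _; rewrite L_delta mulr0.
have ZE i j : (Z *m M - M *m Z) i j =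
    \sum_a \sum_b Z a b * (delta_mx a b *m M - M *m delta_mx a b) i j.
  rewrite {1 2}[Z]matrix_sum_delta mulmx_suml mulmx_sumr -sumrB summxE; apply: eq_bigr => a _.
  rewrite mulmx_suml mulmx_sumr -sumrB summxE; apply: eq_bigr => b _.
  by rewrite -scalemxAl -scalemxAr -scalerBr mxE.
rewrite /L; under eq_bigr => i _ do under eq_bigr => j _ do rewrite ZE mulr_suml.
under eq_bigr => i _ do rewrite exchange_big.
rewrite exchange_big; apply: eq_bigr => a _ /=.
under eq_bigr => i _ do under eq_bigr => j _ do rewrite mulr_suml.
under eq_bigr => i _ do rewrite exchange_big.
rewrite exchange_big; apply: eq_bigr => b _ /=.
rewrite mulr_sumr; apply: eq_bigr => i _; rewrite mulr_sumr; apply: eq_bigr => j _.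
by rewrite mulrA.
Qed.

(** With G in place of g, both sides solve the same equation and agree at 0; the claim is their
    equality at 1. In the derivative of q along M the commutator contributes 0 by invariance, and
    the multiple of M contributes d times q by Euler's identity. *)
Lemma dhomog_invariant_path d (q : S) :
    q \is [in K[n * n], d.-homog] -> q \in @gl_invariant_pred K n ->
  q.@[mxvec (g *m Y0 *m \adj g) 0] = (\det g) ^+ d * q.@[mxvec Y0 0].
Proof.
move=> qd q_inv.
have horner_map_mx (W : 'M[{poly K}]_n) x i j : (W i j).[x] = (map_mx (horner_eval x) W) i j.
  by rewrite mxE.
have G0 : map_mx (horner_eval 0) G = 1%:M.
  apply/matrixP => i j; rewrite !mxE /horner_eval hornerD hornerM hornerX mul0r addr0.
  by rewrite hornerMn hornerC.
have G1 : map_mx (horner_eval 1) G = g.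
  apply/matrixP => i j; rewrite !mxE /horner_eval hornerD hornerM hornerX mul1r hornerC.
  by rewrite hornerMn hornerC addrCA subrr addr0.
have Ex x : (ev q).[x] = q.@[mxvec (map_mx (horner_eval x) M) 0].
  rewrite horner_mmap; apply: meval_eq => v; case/mxvec_indexP: v => i j.
  by rewrite !mxvecE [RHS]mxE.
have Mx x : map_mx (horner_eval x) M
    = map_mx (horner_eval x) G *m Y0 *m \adj (map_mx (horner_eval x) G).
  rewrite !map_mxM map_mx_adj; congr (_ *m _ *m _).
  by apply/matrixP => i j; rewrite !mxE /= /horner_eval hornerC.
have detx x : (\det G).[x] = \det (map_mx (horner_eval x) G) by rewrite det_map_mx.
pose D := ev q - (\det G) ^+ d * (q.@[mxvec Y0 0])%:P.
have adj1 : \adj (1%:M : 'M[K]_n) = 1%:M.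
  by rewrite -[LHS]mul1mx mul_mx_adj det1.
suff D0 : D = 0.
  have := congr1 (fun q : {poly K} => q.[1]) D0; rewrite hornerD hornerN hornerM horner_exp hornerC.
  by rewrite Ex Mx detx G1 horner0 => /eqP; rewrite subr_eq0 => /eqP.
apply: (@poly_ode_eq0 d (\det G)).
- by rewrite detx G0 det1 oner_eq0.
- rewrite hornerD hornerN hornerM horner_exp hornerC Ex Mx detx G0 det1 expr1n mul1r.
  by rewrite mul1mx adj1 mulmx1 subrr.
have dev : \det G * (ev q)^`() = (\det G)^`() * ev q *+ d.
  rewrite deriv_mmap.
  rewrite sum_mxvec.
  under eq_bigr => i _ do under eq_bigr => j _ do rewrite mxvecE.
  rewrite mulr_sumr; under eq_bigr => i _ do rewrite mulr_sumr.
  have dME i j : \det G * (M i j)^`() =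
      ((X *m \adj G) *m M - M *m (X *m \adj G)) i j + (\det G)^`() * M i j.
    have := congr1 (fun W : 'M[{poly K}]_n => W i j) dM.
    by rewrite mxE [in LHS]mxE [in RHS]mxE [X in _ = _ + X -> _]mxE.
  under eq_bigr => i _ do under eq_bigr => j _ do rewrite mulrA dME mulrDl.
  under eq_bigr => i _ do rewrite big_split.
  rewrite big_split /= ev_ad // add0r.
  have := congr1 ev (euler_dhomog qd); rewrite rmorphMn rmorph_sum /=.
  rewrite [X in X = _ -> _]sum_mxvec.
  rewrite -mulrnAr => <-; rewrite mulr_sumr; apply: eq_bigr => i _.
  rewrite mulr_sumr; apply: eq_bigr => j _.
  by rewrite rmorphM /= mmapX mmap1U mxvecE mulrA.
rewrite /D derivB derivM derivC mulr0 addr0 mulrBr dev mulrBr mulrnBl; congr (_ - _).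
case: (d) => [|d']; first by rewrite expr0 derivC mul0r mulr0 mulr0n.
by rewrite deriv_exp exprS /=; ring.
Qed.

End Path.

(** On each homogeneous component of degree d, replacing the inverse of g by the adjugate costs the
    factor (det g)^d, which is exactly the factor gained along the path. *)
Lemma gl_invariant_conj (p : S) (g Y0 : 'M[K]_n) :
    p \in @gl_invariant_pred K n -> g \in unitmx ->
  eval_at (g *m Y0 *m invmx g) p = eval_at Y0 p.
Proof.
move=> p_inv gU; rewrite (@pihomog_partitionE _ _ mdeg (msize p) p) //.
rewrite /eval_at !rmorph_sum; apply: eq_bigr => d _ /=.
have qd := pihomogP mdeg d p; set q := pihomog mdeg d p in qd *.
have q_inv : q \in @gl_invariant_pred K n.
  apply/gl_invariantP => X; rewrite -pihomog_ad_action.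
  by rewrite (gl_invariantP _ p_inv) raddf0.
have dg0 : \det g != 0 by rewrite -unitfE -unitmxE.
apply: (mulfI (expf_neq0 d dg0)); rewrite -(dhomog_invariant_path g Y0 qd q_inv).
rewrite -(dhomog_scale _ _ qd); apply: meval_eq => v; case/mxvec_indexP: v => i j.
rewrite !mxvecE /invmx gU -scalemxAr mxE mulrA divff ?mul1r //.
Qed.

End Invariance.

(** * Generators of the big algebras *)

Section BigGenerators.
Variables (K : numFieldType) (n : nat) (V : rep_data K n).
Hypothesis V_good : good_rep V.
Local Notation S := {mpoly K[n * n]}.
Local Notation SEnd := 'M[S]_(rep_dim V).
Local Notation Y := (generic_mx K n).
Local Notation c := (char_coef K n).
Local Notation const := (@const_mpoly K n).
Local Notation grad := (char_grad K n).
Local Notation rho i j := (map_mx const (rep_diff V (delta_mx i j))).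

Fact const_zmod_morphism : zmod_morphism const.
Proof. exact: raddfB. Qed.

Fact const_monoid_morphism : monoid_morphism const.
Proof. split; [exact: mpolyC1 | exact: mpolyCM]. Qed.

HB.instance Definition _ :=
  GRing.isZmodMorphism.Build K S const const_zmod_morphism.
HB.instance Definition _ :=
  GRing.isMonoidMorphism.Build K S const const_monoid_morphism.

Definition diff_ext (G : 'M[S]_n) : SEnd := \sum_i \sum_j G i j *: rho i j.

Fact diff_ext_linear : linear diff_ext.
Proof.
move=> a G H; rewrite /diff_ext scaler_sumr -big_split; apply: eq_bigr => i _ /=.
rewrite scaler_sumr -big_split; apply: eq_bigr => j _ /=.
by rewrite !mxE scalerDl scalerA.
Qed.

HB.instance Definition _ :=
  GRing.isLinear.Build S 'M[S]_n SEnd _ diff_ext diff_ext_linear.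

Lemma diff_extZ a G : diff_ext (a *: G) = a *: diff_ext G.
Proof. exact: linearZ_LR. Qed.

Lemma diff_extB G H : diff_ext (G - H) = diff_ext G - diff_ext H.
Proof. exact: raddfB. Qed.

Lemma diff_ext0 : diff_ext 0 = 0.
Proof. exact: raddf0. Qed.

Lemma kirillov_wei_scalar (p : S) :
  kirillov_wei (p%:M : SEnd) = diff_ext (\matrix_(i, j) dcoord j i p).
Proof.
apply: eq_bigr => i _; apply: eq_bigr => j _; rewrite mxE -mul_scalar_mx; congr (_ *m _).
apply/matrixP => k l; rewrite !mxE /dcoord.
by case: eqP => _; rewrite ?mulr1n // !mulr0n mderiv0.
Qed.

Lemma kirillov_weiZ (a : K) (F : SEnd) :
  kirillov_wei (const a *: F) = const a *: kirillov_wei F.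
Proof.
rewrite /kirillov_wei scaler_sumr; apply: eq_bigr => i _.
rewrite scaler_sumr; apply: eq_bigr => j _; rewrite scalemxAl; congr (_ *m _).
by apply/matrixP => k l; rewrite !mxE /dcoord mderiv_mulC.
Qed.

Lemma dcoord_mx i j (G : 'M[S]_n) :
  map_mx (dcoord i j) (diff_ext G) = diff_ext (map_mx (dcoord i j) G).
Proof.
apply/matrixP => s t; rewrite mxE /diff_ext !summxE /dcoord raddf_sum.
apply: eq_bigr => k _; rewrite !summxE raddf_sum; apply: eq_bigr => l _ /=.
by rewrite !mxE /const_mpoly ![_ * _%:MP]mulrC mderiv_mulC.
Qed.

(* Writing E_kl E_ij = :E_kl E_ij: + d_li E_kj, the normally ordered part is
   symmetric in k and i and pairs to 0 with the alternating second derivatives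
   of c_(k+1), while the contraction contributes a derivative of the trace
   direction, which lowers the degree. *)
Lemma kirillov_wei_grad k : (k < n)%N ->
  kirillov_wei (diff_ext (grad k.+1)) = - (const (n - k)%:R *: diff_ext (grad k)).
Proof.
move=> kn; pose h i j a b := dcoord j i (dcoord b a (c k.+1)).
pose W i j a b : SEnd := rho a b *m rho i j - (b == i)%:R *: rho a j.
have hW i j a b : h i j a b *: W i j a b = - (h a j i b *: W a j i b).
  have -> : W i j a b = W a j i b.
    have := congr1 (map_mx const) (rep_diff_order V_good i j a b).
    have constR (x : bool) : const x%:R = x%:R by rewrite rmorph_nat.
    by rewrite !map_mxB !map_mxZ /= !constR !map_mxM.
  by rewrite /h dcoord_char_coef_alt scaleNr.
have W0 : \sum_i \sum_j \sum_a \sum_b h i j a b *: W i j a b = 0.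
  set T := \sum_i _; have : T = - T.
    rewrite /T {1}exchange_big [in RHS]exchange_big -sumrN; apply: eq_bigr => j _ /=.
    rewrite {1}exchange_big -sumrN; apply: eq_bigr => i _ /=.
    rewrite -sumrN; apply: eq_bigr => a _; rewrite -sumrN; apply: eq_bigr => b _.
    by rewrite hW.
  move/eqP; rewrite -addr_eq0 => /eqP TT; have half : const 2^-1 + const 2^-1 = 1.
    transitivity (const (2^-1 + 2^-1)); first by rewrite rmorphD.
    by rewrite -[2^-1]mul1r -splitr rmorph1.
  by rewrite -[T]scale1r -half scalerDl -scalerDr TT scaler0.
transitivity (\sum_i \sum_j \sum_a \sum_b h i j a b *: (rho a b *m rho i j)).
  apply: eq_bigr => i _; apply: eq_bigr => j _; rewrite dcoord_mx mulmx_suml.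
  apply: eq_bigr => a _; rewrite mulmx_suml; apply: eq_bigr => b _.
  by rewrite -scalemxAl !mxE.
have -> : \sum_i \sum_j \sum_a \sum_b h i j a b *: (rho a b *m rho i j)
    = \sum_i \sum_j \sum_a h i j a i *: rho a j.
  apply/eqP; rewrite -subr_eq0; apply/eqP; rewrite -[RHS]W0 -sumrB; apply: eq_bigr => i _.
  rewrite -sumrB; apply: eq_bigr => j _; rewrite -sumrB; apply: eq_bigr => a _.
  rewrite /W; under [RHS]eq_bigr => b _ do rewrite scalerBr.
  rewrite sumrB; congr (_ - _); rewrite (bigD1 i) //= big1 => [|b bi].
    by rewrite eqxx scale1r addr0.
  by rewrite (negbTE bi) scale0r scaler0.
rewrite exchange_big /=; under eq_bigr => j _ do rewrite exchange_big.
rewrite exchange_big /= scaler_sumr -sumrN; apply: eq_bigr => a _.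
rewrite scaler_sumr -sumrN; apply: eq_bigr => j _; rewrite -scaler_suml scalerA -scaleNr.
congr (_ *: _); rewrite mxE.
(* Alternation turns d_ji d_ia into - d_ja d_ii, so the sum over i is a derivative of the trace
   derivative of c_(k+1); this gives both the sign and the factor n - k. *)
under eq_bigr => i _ do rewrite /h dcoord_char_coef_alt.
rewrite sumrN; congr (- _); rewrite /dcoord -raddf_sum /=.
have := dcoord_trace_char_coef K kn; rewrite /dcoord => ->.
by rewrite mderivMn rmorph_nat mulr_natl.
Qed.

(** After the first application, D only lowers the index of the gradient and multiplies by a
    constant, until it reaches G_0 = 0. *)
Lemma iter_kirillov_wei_char_coef q k : (k <= n)%N ->
  exists (a : K) (l : nat), (l <= n)%N /\
    iter q.+1 (@kirillov_wei K n V) (c k)%:M = const a *: diff_ext (grad l).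
Proof.
move=> kn; elim: q => [|q [a [l [ln IHq]]]].
  by exists 1, k; split=> //=; rewrite kirillov_wei_scalar rmorph1 scale1r.
rewrite iterS IHq kirillov_weiZ.
case: l ln {IHq} => [|l] ln.
  exists 0, 0%N; split; first by [].
  rewrite char_grad0 diff_ext0 scaler0.
  rewrite [kirillov_wei _]big1 ?scaler0 // => i _; rewrite big1 // => j _.
  by rewrite (_ : map_mx _ _ = 0) ?mul0mx //; apply/matrixP => s t; rewrite !mxE /dcoord mderiv0.
exists (- a * (n - l)%:R), l; split; first exact: ltnW.
by rewrite kirillov_wei_grad // rmorphM rmorphN mulNr scaleNr scalerN scalerA.
Qed.

Fact eval_at_zmod_morphism (Y0 : 'M[K]_n) : zmod_morphism (eval_at Y0).
Proof. exact: mevalB. Qed.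

Fact eval_at_monoid_morphism (Y0 : 'M[K]_n) : monoid_morphism (eval_at Y0).
Proof. split; [exact: meval1 | exact: mevalM]. Qed.

HB.instance Definition _ Y0 :=
  GRing.isZmodMorphism.Build S K (eval_at Y0) (eval_at_zmod_morphism Y0).
HB.instance Definition _ Y0 :=
  GRing.isMonoidMorphism.Build S K (eval_at Y0) (eval_at_monoid_morphism Y0).

Lemma eval_at_generic (Y0 : 'M[K]_n) : map_mx (eval_at Y0) Y = Y0.
Proof. by apply/matrixP => i j; rewrite !mxE /eval_at mevalXU mxvecE. Qed.

Lemma eval_at_const (Y0 : 'M[K]_n) a : eval_at Y0 (const a) = a.
Proof. exact: mevalC. Qed.

(** The recursion G_(k+1) = c_k - Y G_k carries conjugation from k to k + 1, given the group
    invariance of c_k. *)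
Lemma eval_char_grad_conj k (g Y0 : 'M[K]_n) : g \in unitmx ->
  map_mx (eval_at (g *m Y0 *m invmx g)) (grad k)
    = g *m map_mx (eval_at Y0) (grad k) *m invmx g.
Proof.
move=> gU; have [nk|kn] := ltnP n k.
  have -> : grad k = 0 by apply/matrixP => i j; rewrite !mxE char_coef_gt // /dcoord mderiv0.
  by rewrite !map_mx0 mulmx0 mul0mx.
elim: k kn => [|k IHk] kn; first by rewrite char_grad0 !map_mx0 mulmx0 mul0mx.
rewrite char_gradS ?(ltnW kn) // !map_mxB !map_mxM !eval_at_generic IHk ?(ltnW kn) //.
rewrite !map_scalar_mx /= gl_invariant_conj //; last exact: char_coef_invariant.
rewrite mulmxBr mulmxBl mul_mx_scalar -scalemxAl mulmxV // scalemx1; congr (_ - _).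
by rewrite !mulmxA mulmxKV.
Qed.

Lemma eval_diff_ext (Y0 : 'M[K]_n) (G : 'M[S]_n) :
  map_mx (eval_at Y0) (diff_ext G) = rep_diff V (map_mx (eval_at Y0) G).
Proof.
pose f : {linear 'M[K]_n -> 'M[K]_(rep_dim V)} :=
  HB.pack (rep_diff V) (GRing.isLinear.Build K _ _ _ (rep_diff V) (rep_diff_linear V_good)).
rewrite -[rep_diff V]/(f : _ -> _) [map_mx _ G]matrix_sum_delta !linear_sum.
rewrite /diff_ext raddf_sum; apply: eq_bigr => i _.
rewrite linear_sum raddf_sum; apply: eq_bigr => j _; rewrite linearZ /= map_mxZ mxE.
congr (_ *: _); apply/matrixP => s t.
by rewrite !mxE /= eval_at_const.
Qed.

Lemma equivariant_diff_ext_grad k : equivariant (diff_ext (grad k)).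
Proof. by move=> g Y0 gU; rewrite !eval_diff_ext eval_char_grad_conj // rep_diff_conj. Qed.

Lemma equivariant_subalgebra : invariant_subalgebra (@equivariant K n V).
Proof.
split=> [a g Y0 gU|F G eqF eqG g Y0 gU|F G eqF eqG g Y0 gU].
- rewrite !map_scalar_mx /= gl_invariant_conj //; last by case: a.
  by rewrite mul_mx_scalar -scalemxAl rep_actV // scalemx1.
- by rewrite !map_mxD eqF // eqG // mulmxDr mulmxDl.
- rewrite !map_mxM eqF // eqG // -!mulmxA; congr (_ *m (_ *m _)).
  by rewrite !mulmxA (mulmx1C (rep_actV V_good gU)) mul1mx.
Qed.

Fact const_invariant a : const a \in @gl_invariant_pred K n.
Proof.
apply/gl_invariantP => X; rewrite /ad_action big1 // => i _; rewrite big1 // => j _.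
by rewrite /dcoord mderivC mulr0.
Qed.

Definition const_inv a : gl_invariant K n := GlInvariant (const_invariant a).
Definition char_inv k : gl_invariant K n := GlInvariant (char_coef_invariant K n k).

(** [big_pred] only admits predicates that imply equivariance, so it is applied to P together with
    [equivariant]. The generators with q = 0 are invariants, and those with q > 0 are constant
    multiples of some pi(G_l). *)
Lemma big_pred_ind (P : SEnd -> Prop) :
    invariant_subalgebra P -> (forall k, (k <= n)%N -> P (diff_ext (grad k))) ->
  forall F, F \in @big_pred K n V -> P F /\ equivariant F.
Proof.
move=> [PA PD PM] Pgen F; have [EA ED EM] := equivariant_subalgebra.
move=> /asboolP/(_ (fun G => P G /\ equivariant G)); apply=> [|G []//|p q pqn].
  split=> [a|G H [PG EG] [PH EH]|G H [PG EG] [PH EH]].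
  - by split; [apply: PA|apply: EA].
  - by split; [apply: PD|apply: ED].
  - by split; [apply: PM|apply: EM].
case: q pqn => [|q] pqn.
  by split; [apply: (PA (char_inv _))|apply: (EA (char_inv _))].
have [a [l [ln ->]]] := iter_kirillov_wei_char_coef q pqn.
rewrite -mul_scalar_mx; split.
  by apply: (PM); [apply: (PA (const_inv a))|apply: Pgen].
by apply: (EM); [apply: (EA (const_inv a))|apply: equivariant_diff_ext_grad].
Qed.

Lemma big_equivariant F : F \in @big_pred K n V -> equivariant F.
Proof. by move=> bF; have [] := big_pred_ind (P := fun=> True) _ _ bF. Qed.

Lemma big_subalgebra : invariant_subalgebra (fun F : SEnd => F \in @big_pred K n V).
Proof.
split=> [a|F G /asboolP bF /asboolP bG|F G /asboolP bF /asboolP bG].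
- exact: big_map_subproof.
- by apply/asboolP => P subP eqP genP; have [_ PD _] := subP; apply: PD; [apply: bF|apply: bG].
- by apply/asboolP => P subP eqP genP; have [_ _ PM] := subP; apply: PM; [apply: bF|apply: bG].
Qed.

Lemma diff_ext_grad_big k : (k <= n)%N -> diff_ext (grad k) \in @big_pred K n V.
Proof.
case: k => [|k] kn.
  rewrite char_grad0 diff_ext0; have [bA _ _] := big_subalgebra.
  by have := bA 0; rewrite !raddf0.
apply/asboolP => P subP eqP genP; have := genP k 1%N; rewrite addn1 => /(_ kn).
by rewrite /= kirillov_wei_scalar.
Qed.

End BigGenerators.

(** * Powers of Y and the Cayley-Hamilton relation *)

Section Powers.
Variables (K : numFieldType) (n' : nat).
Local Notation n := n'.+1.
Local Notation S := {mpoly K[n * n]}.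
Local Notation A := (gl_invariant K n).
Local Notation Y := (generic_mx K n).
Local Notation grad := (char_grad K n).

(** From Y^(j+1) G_k = c_k Y^j - Y^j G_(k+1), induction on j for all k at once puts pi(Y^j G_k) in
    the big algebra; each step trades a power of Y for a higher index, so j + k stays at most n.
    Powers of Y are the case G_1 = 1. *)
Lemma diff_ext_pow_big (V : rep_data K n) : good_rep V ->
  forall k, (k < n)%N -> diff_ext V (Y ^+ k) \in @big_pred K n V.
Proof.
move=> V_good; have [bA bD bM] := big_subalgebra V.
have bZ (a : A) M : diff_ext V M \in @big_pred K n V -> diff_ext V (val a *: M) \in @big_pred K n V.
  by move=> bM'; rewrite diff_extZ -mul_scalar_mx; exact: (bM _ _ (bA a) bM').
have grad1 : grad 1 = 1 by rewrite char_gradS // char_grad0 mulmx0 subr0 char_coef0.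
have H j : forall k, (0 < k)%N -> (j + k <= n)%N ->
    diff_ext V (Y ^+ j * grad k) \in @big_pred K n V.
  elim: j => [|j IHj] k k0 jkn; first by rewrite mul1r diff_ext_grad_big.
  have Yg : Y *m grad k = (char_coef K n k)%:M - grad k.+1.
    have kn : (k <= n)%N by apply: leq_trans jkn; apply: leq_addl.
    rewrite char_gradS //.
    rewrite opprB [RHS]addrCA.
    by rewrite subrr addr0.
  have YYg : Y ^+ j.+1 * grad k = Y ^+ j *m (char_coef K n k)%:M - Y ^+ j * grad k.+1.
    by rewrite exprSr -mulrA -[Y * _]/(Y *m _) Yg -[RHS]mulmxBr.
  rewrite YYg diff_extB -mulN1r; apply: (bD).
    rewrite mul_mx_scalar; apply: (bZ (char_inv K n k)).
    by rewrite -[Y ^+ j]mulr1 -grad1; apply: IHj; lia.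
  apply: (bM); last by apply: IHj; lia.
  by have := bA (-1); rewrite !raddfN.
by move=> k kn; rewrite -[Y ^+ k]mulr1 -grad1; apply: H; lia.
Qed.

Lemma vector_diff_ext (G : 'M[S]_n) : diff_ext (vector_rep K n) G = G.
Proof.
rewrite [RHS]matrix_sum_delta; apply: eq_bigr => i _; apply: eq_bigr => j _.
by congr (_ *: _); apply/matrixP => s t; rewrite !mxE /=; case: (_ && _); rewrite ?rmorph1 ?rmorph0.
Qed.

Definition inv_poly_eval (q : {poly A}) : 'M[S]_n := horner_mx Y (map_poly val q).

Lemma inv_poly_evalB p q : inv_poly_eval (p - q) = inv_poly_eval p - inv_poly_eval q.
Proof. by rewrite /inv_poly_eval !raddfB. Qed.

Lemma inv_poly_evalD p q : inv_poly_eval (p + q) = inv_poly_eval p + inv_poly_eval q.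
Proof. by rewrite /inv_poly_eval !raddfD. Qed.

Lemma inv_poly_evalM p q : inv_poly_eval (p * q) = inv_poly_eval p *m inv_poly_eval q.
Proof. by rewrite /inv_poly_eval !rmorphM. Qed.

Lemma inv_poly_evalC a : inv_poly_eval a%:P = (val a)%:M.
Proof. by rewrite /inv_poly_eval map_polyC horner_mx_C. Qed.

Lemma inv_poly_evalX : inv_poly_eval 'X = Y.
Proof. by rewrite /inv_poly_eval map_polyX horner_mx_X. Qed.

Lemma inv_poly_evalXn k : inv_poly_eval 'X^k = Y ^+ k.
Proof.
elim: k => [|k IHk]; first by rewrite !expr0 -[1]/(1%:P) inv_poly_evalC rmorph1.
by rewrite !exprS inv_poly_evalM inv_poly_evalX IHk.
Qed.

(** The recursion of [char_gradS] read in A[X]. At n + 1 it gives, up to sign, the characteristic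
    polynomial of Y. *)
Fixpoint grad_poly k : {poly A} :=
  if k is k'.+1 then (char_inv K n k')%:P - 'X * grad_poly k' else 0.

Lemma grad_polyE k : (k <= n.+1)%N -> inv_poly_eval (grad_poly k) = grad k.
Proof.
elim: k => [|k IHk] kn; first by rewrite char_grad0 /= -[0](subrr 0) inv_poly_evalB subrr.
have -> : grad k.+1 = (char_coef K n k)%:M - Y *m grad k by rewrite char_gradS.
by rewrite -IHk 1?ltnW //= inv_poly_evalB inv_poly_evalM inv_poly_evalC inv_poly_evalX.
Qed.

Lemma lead_grad_poly k : exists2 q : {poly A}, (size q <= k)%N &
  grad_poly k.+1 = (-1) ^+ k *: 'X^k + q.
Proof.
elim: k => [|k [q sq E]].
  exists 0; rewrite ?size_poly0 //= mulr0 subr0 addr0 scale1r.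
  by congr _%:P; apply: val_inj; rewrite /= char_coef0.
exists ((char_inv K n k.+1)%:P - 'X * q).
  apply: leq_trans (size_polyD _ _) _; rewrite geq_max size_polyN.
  rewrite (leq_trans (size_polyC_leq1 _)) // mulrC.
  by have [->|q0] := eqVneq q 0; rewrite ?mul0r ?size_poly0 // size_mulX.
rewrite [LHS]/= -/(grad_poly k.+1) E mulrDr opprD -scalerAr -exprS [(-1) ^+ k.+1]exprS.
by rewrite mulN1r scaleNr addrCA addrA.
Qed.

(** The elements are polynomials in Y with invariant coefficients. Up to sign [grad_poly n.+1] is
    monic of degree n and its value at Y is G_(n+1) = 0, so the remainder modulo it has the same
    value at Y. *)
Lemma big_vector_span (F : 'M[S]_n) : F \in @big_pred K n (vector_rep K n) ->
  exists a : 'I_n -> A, F = \sum_j val (a j) *: Y ^+ j.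
Proof.
move=> bF; pose P (G : 'M[S]_n) := exists q, G = inv_poly_eval q.
have [] : P F /\ equivariant (V := vector_rep K n) F.
  apply: (big_pred_ind (vector_good_rep K n)) bF => [|k kn].
    split=> [a|_ _ [p ->] [q ->]|_ _ [p ->] [q ->]].
    - by exists a%:P; rewrite inv_poly_evalC.
    - by exists (p + q); rewrite inv_poly_evalD.
    - by exists (p * q); rewrite inv_poly_evalM.
  by exists (grad_poly k); rewrite vector_diff_ext grad_polyE // ltnW.
move=> [q ->] _.
have [r sr E] := lead_grad_poly n.
pose m := (-1) ^+ n *: grad_poly n.+1.
have mE : m = 'X^n + (-1) ^+ n *: r.
  by rewrite /m E scalerDr scalerA -exprD addnn -mul2n exprM sqrrN !expr1n scale1r.
have lt_rX : (size ((-1) ^+ n *: r) < size ('X^n : {poly A}))%N.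
  by rewrite size_polyXn ltnS (leq_trans (size_scale_leq _ _)).
have mM : m \is monic by rewrite monicE mE lead_coefDl // lead_coefXn.
have g0 : inv_poly_eval (grad_poly n.+1) = 0.
  by rewrite grad_polyE //; apply/matrixP => i j; rewrite !mxE char_coef_gt // /dcoord mderiv0.
have m0 : inv_poly_eval m = 0 by rewrite /m -mul_polyC inv_poly_evalM g0 mulmx0.
rewrite (Pdiv.RingMonic.rdivp_eq mM q).
set s := Pdiv.Ring.rmodp q m.
have ss : (size s <= n)%N.
  rewrite -ltnS; have := Pdiv.Ring.ltn_rmodpN0 q (monic_neq0 mM).
  by rewrite [in size m]mE size_polyDl // size_polyXn.
exists (fun j => s`_j).
rewrite [inv_poly_eval _](_ : _ = inv_poly_eval s); last first.
  by rewrite inv_poly_evalD inv_poly_evalM m0 mulmx0 add0r.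
have sE : s = \sum_(j < n) (s`_j)%:P * 'X^j.
  rewrite -{1}(coefK s) poly_def (big_ord_widen _ (fun j => s`_j *: 'X^j) ss) big_mkcond.
  apply: eq_bigr => j _; rewrite mul_polyC; case: ltnP => // sj.
  by rewrite nth_default // scale0r.
have ev0 : inv_poly_eval 0 = 0 by rewrite -(subrr 0) inv_poly_evalB subrr.
rewrite [in LHS]sE (big_morph _ inv_poly_evalD ev0); apply: eq_bigr => j _.
by rewrite inv_poly_evalM inv_poly_evalC inv_poly_evalXn mul_scalar_mx.
Qed.

End Powers.

(** * Density of the diagonalizable matrices *)

Section Density.
Variables (K : numClosedFieldType) (n' : nat).
Local Notation n := n'.+1.
Local Notation S := {mpoly K[n * n]}.

Lemma char_poly_conj (g A : 'M[K]_n) : g \in unitmx ->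
  char_poly (g *m A *m invmx g) = char_poly A.
Proof.
move=> gU; have gP : map_mx polyC g *m map_mx polyC (invmx g) = 1%:M :> 'M[{poly K}]_n.
  by rewrite -map_mxM mulmxV // map_mx1.
rewrite /char_poly /char_poly_mx !map_mxM.
have -> : 'X%:M - map_mx polyC g *m map_mx polyC A *m map_mx polyC (invmx g) =
    map_mx polyC g *m ('X%:M - map_mx polyC A) *m map_mx polyC (invmx g).
  rewrite mulmxBr mulmxBl; congr (_ - _).
  by rewrite mul_mx_scalar -scalemxAl gP scalemx1.
by rewrite !det_mulmx mulrAC -det_mulmx gP det1 mul1r.
Qed.

Lemma char_poly_diag_mx (d : 'rV[K]_n) :
  char_poly (diag_mx d) = \prod_(x <- [seq d 0 i | i <- enum 'I_n]) ('X - x%:P).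
Proof.
rewrite char_poly_trig ?diag_mx_is_trig // big_image /=.
by apply: eq_bigr => i _; rewrite mxE eqxx.
Qed.

Lemma separable_diagonalizable (A : 'M[K]_n) : separable_poly (char_poly A) ->
  exists (g : 'M[K]_n) (d : 'rV[K]_n),
    [/\ g \in unitmx, injective (d 0) & A = g *m diag_mx d *m invmx g].
Proof.
move=> sepA; have [rs charA] := closed_field_poly_normal (char_poly A).
rewrite (monicP (char_poly_monic A)) scale1r in charA.
have urs : uniq rs by rewrite -separable_prod_XsubC -charA.
have /diagonalizableP[P PU /(diagonalizable_forLR PU)[d Ad]] :
    exists2 rs, uniq rs & mxminpoly A %| \prod_(x <- rs) ('X - x%:P).
  by exists rs => //; rewrite -charA mxminpoly_dvd_char.
rewrite mxpoly.conjVmx // in Ad.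
have AE : A = invmx P *m diag_mx d *m invmx (invmx P) by rewrite invmxK.
exists (invmx P), d; split=> //; first by rewrite unitmx_inv.
move: sepA; rewrite AE char_poly_conj ?unitmx_inv // char_poly_diag_mx separable_prod_XsubC.
by move=> /injectiveP; rewrite /injectiveb /dinjectiveb; apply.
Qed.

(** Evaluation commutes with the resultant when leading coefficients survive; for the derivative of
    a characteristic polynomial the leading coefficient is the nonzero constant n. *)
Lemma lead_coef_deriv_monic (R : nzRingType) (p : {poly R}) :
  p \is monic -> (size p).-1%:R != 0 :> R -> lead_coef p^`() = (size p).-1%:R.
Proof.
move=> /monicP p1 spR; have sp0 : ((size p).-1 != 0)%N by apply: contraNneq spR => ->.
have c : p^`()`_((size p).-2) = (size p).-1%:R.
  by rewrite coef_deriv prednK ?lt0n // -lead_coefE p1.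
rewrite lead_coefE -[RHS]c; congr _`_(_).-1; apply/anti_leq/andP; split.
  rewrite -ltnS prednK ?lt0n //; last by apply: contraNneq sp0 => ->.
  by apply: lt_size_deriv; apply: contraNneq sp0 => ->; rewrite size_poly0.
rewrite -(prednK (n := (size p).-1)) ?lt0n // ltnNge; apply/negP => /leq_sizeP/(_ _ (leqnn _))/eqP.
by rewrite c (negbTE spR).
Qed.

(** Y0 is joined by a line to a diagonal matrix with entries 0, ..., n - 1. The resultant r of the
    characteristic polynomial and its derivative along the line is nonzero at that end, hence as a
    polynomial; p restricted to the line vanishes wherever r does not, so it is 0. *)
Lemma density (p : S) :
    (forall (g : 'M[K]_n) (d : 'rV[K]_n), g \in unitmx -> injective (d 0) ->
       eval_at (g *m diag_mx d *m invmx g) p = 0) ->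
  p = 0.
Proof.
move=> p0; apply: mpoly_eq0_eval => v.
pose Y0 : 'M[K]_n := \matrix_(i, j) v (mxvec_index i j).
pose D0 : 'M[K]_n := diag_mx (\row_i (i : nat)%:R).
pose N : 'M[{poly K}]_n := (1 - 'X) *: map_mx polyC Y0 + 'X *: map_mx polyC D0.
have Nx x : map_mx (horner_eval x) N = (1 - x) *: Y0 + x *: D0.
  apply/matrixP => i j; rewrite !mxE /horner_eval hornerD !hornerM hornerD hornerN.
  by rewrite !hornerE.
pose chi := char_poly N; pose r := resultant chi chi^`().
pose F := mmap polyC (fun v => mxvec N 0 v) p.
have Fx x : F.[x] = eval_at (map_mx (horner_eval x) N) p.
  rewrite horner_mmap; apply: meval_eq => w; case/mxvec_indexP: w => i j.
  by rewrite !mxvecE [RHS]mxE.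
have chi_monic : chi \is monic by apply: char_poly_monic.
have chi_size : size chi = n.+1 by apply: size_char_poly.
have chi_x x : map_poly (horner_eval x) chi = char_poly (map_mx (horner_eval x) N).
  by rewrite map_char_poly.
have rx x : (r.[x] != 0) = separable_poly (char_poly (map_mx (horner_eval x) N)).
  rewrite -[r.[x]]/(horner_eval x r) map_resultant ?(monicP chi_monic) ?rmorph1 ?oner_eq0 //.
    rewrite -deriv_map chi_x resultant_eq0 -leqNgt.
    rewrite leq_eqVlt ltnS leqn0 size_poly_eq0 gcdp_eq0.
    by rewrite (negbTE (monic_neq0 (char_poly_monic _))) orbF separable_poly.unlock coprimep_def.
  have n0 : n%:R != 0 :> {poly K} by rewrite -polyC_natr polyC_eq0 pnatr_eq0.
  by rewrite (lead_coef_deriv_monic chi_monic) chi_size //= rmorph_nat pnatr_eq0.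
have r1 : r != 0.
  suff : r.[1] != 0 by apply: contraNneq => ->; rewrite horner0.
  rewrite rx Nx subrr scale0r scale1r add0r char_poly_diag_mx separable_prod_XsubC.
  rewrite map_inj_uniq ?enum_uniq // => i j; rewrite !mxE => /eqP.
  by rewrite eqr_nat => /eqP/val_inj.
have F0 : F = 0.
  have : r * F = 0.
    apply: poly_eq0_eval => x; rewrite hornerM.
    have [->|] := eqVneq r.[x] 0; first by rewrite mul0r.
    rewrite rx => /separable_diagonalizable[g [d [gU d_inj E]]].
    by rewrite Fx E p0 ?mulr0.
  by move/eqP; rewrite mulf_eq0 (negbTE r1) => /eqP.
have := Fx 0; rewrite F0 horner0 Nx subr0 scale1r scale0r addr0 => ->.
by apply: meval_eq => w; case/mxvec_indexP: w => i j; rewrite mxvecE mxE.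
Qed.

Lemma equivariant_eq0 (V : rep_data K n) (F : 'M[S]_(rep_dim V)) : equivariant F ->
  (forall d : 'rV[K]_n, injective (d 0) -> map_mx (eval_at (diag_mx d)) F = 0) -> F = 0.
Proof.
move=> eqF F0; apply/matrixP => s t; rewrite mxE; apply: density => g d gU d_inj.
have := congr1 (fun M : 'M_(rep_dim V) => M s t) (eqF g (diag_mx d) gU).
by rewrite F0 // mulmx0 mul0mx !mxE.
Qed.

End Density.

(** * Tensor powers *)

Section Restriction.
Variables (A C : comNzRingType) (r : {rmorphism A -> C}).

(* C, viewed as an A-module through r: fglift requires a module over A. *)
Definition restricted of {rmorphism A -> C} : Type := C.
HB.instance Definition _ := GRing.Zmodule.copy (restricted r) C.

Definition restricted_scale (a : A) (x : restricted r) : restricted r := (r a * (x : C) : C).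

Fact restricted_scaleA a b x :
  restricted_scale a (restricted_scale b x) = restricted_scale (a * b) x.
Proof. by rewrite /restricted_scale rmorphM mulrA. Qed.

Fact restricted_scale1 : left_id 1 restricted_scale.
Proof. by move=> x; rewrite /restricted_scale rmorph1 mul1r. Qed.

Fact restricted_scaleDr : right_distributive restricted_scale +%R.
Proof. by move=> a x y; rewrite /restricted_scale mulrDr. Qed.

Fact restricted_scaleDl x : {morph restricted_scale^~ x : a b / a + b}.
Proof. by move=> a b; rewrite /restricted_scale rmorphD mulrDl. Qed.

HB.instance Definition _ := GRing.Zmodule_isLmodule.Build A (restricted r)
  restricted_scaleA restricted_scale1 restricted_scaleDr restricted_scaleDl.
End Restriction.

(** * Evaluation of tensors by one ring morphism per slot *)

Section TensorEval.
Variables (A C : comNzRingType) (r : {rmorphism A -> C}) (B : algebra A) (m : nat).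
Variable e : 'I_m -> {rmorphism B -> C}.
Hypothesis e_map : forall k a, e k (alg_map B a) = r a.
Local Notation pure := {ffun 'I_m -> B}.
Local Notation formal := {freeg pure / A}.

Definition formal_eval (u : formal) : C :=
  fglift (fun x : pure => (\prod_k e k (x k) : restricted r)) u.

Lemma formal_evalU x : formal_eval << x >> = \prod_k e k (x k).
Proof. by rewrite /formal_eval fgliftU. Qed.

Lemma formal_evalZ a u : formal_eval (a *: u) = r a * formal_eval u.
Proof. by rewrite /formal_eval fgliftZ. Qed.

Lemma formal_evalD u v : formal_eval (u + v) = formal_eval u + formal_eval v.
Proof. by rewrite /formal_eval fgliftD. Qed.

Lemma formal_evalB u v : formal_eval (u - v) = formal_eval u - formal_eval v.
Proof. by rewrite /formal_eval fgliftB. Qed.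

Lemma formal_eval0 : formal_eval 0 = 0.
Proof. by rewrite /formal_eval fglift0. Qed.

Lemma formal_eval_null u : tensor_null u -> formal_eval u = 0.
Proof.
have prodD1 k (x : pure) :
    \prod_j e j (x j) = e k (x k) * \prod_(j | j != k) e j (x j) by rewrite (bigD1 k).
elim=> {u} [|c u v _ IHu _ IHv|k b b1 b2 bk bj|k c b b1 bk bj].
- exact: formal_eval0.
- by rewrite formal_evalD formal_evalZ IHu IHv mulr0 addr0.
- have E1 : \prod_(j | j != k) e j (b1 j) = \prod_(j | j != k) e j (b j).
    by apply: eq_bigr => j /bj[->].
  have E2 : \prod_(j | j != k) e j (b2 j) = \prod_(j | j != k) e j (b j).
    by apply: eq_bigr => j /bj[_ ->].
  rewrite formal_evalB formal_evalD !formal_evalU !(prodD1 k) E1 E2 bk rmorphD mulrDl.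
  exact: subrr.
- have E1 : \prod_(j | j != k) e j (b1 j) = \prod_(j | j != k) e j (b j).
    by apply: eq_bigr => j /bj ->.
  rewrite formal_evalB formal_evalZ !formal_evalU !(prodD1 k) E1 bk rmorphM e_map mulrA.
  exact: subrr.
Qed.

Definition tensor_eval (t : tensor_power B m) : C := formal_eval (tensor_repr t).

Lemma tensor_eval_pi u : tensor_eval (tensor_pi u) = formal_eval u.
Proof.
by apply/eqP; rewrite -subr_eq0 -formal_evalB formal_eval_null //; apply: tensor_null_repr.
Qed.

Lemma tensor_evalD s t : tensor_eval (s + t) = tensor_eval s + tensor_eval t.
Proof.
rewrite -[s]tensor_reprK -[t]tensor_reprK -raddfD !tensor_eval_pi.
exact: formal_evalD.
Qed.

Lemma tensor_evalB s t : tensor_eval (s - t) = tensor_eval s - tensor_eval t.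
Proof.
rewrite -[s]tensor_reprK -[t]tensor_reprK -raddfB !tensor_eval_pi.
exact: formal_evalB.
Qed.

Lemma tensor_evalM (s t : tensor_power B m) :
  tensor_eval (s * t) = tensor_eval s * tensor_eval t.
Proof.
rewrite -[s]tensor_reprK -[t]tensor_reprK -[X in tensor_eval X]tensor_piM !tensor_eval_pi.
move: (tensor_repr s) (tensor_repr t) => u v {s t}.
elim/formal_ind: u => [|a x u IHu]; first by rewrite formal_mul0l formal_eval0 mul0r.
rewrite formal_mulDl formal_mulZl !formal_evalD !formal_evalZ IHu mulrDl -mulrA.
congr (_ * _ + _) => {a u IHu}.
elim/formal_ind: v => [|a y v IHv]; first by rewrite formal_mul0r formal_eval0 mulr0.
rewrite formal_mulDr formal_mulZr !formal_evalD !formal_evalZ IHv mulrDr mulrCA.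
congr (_ * _ + _); rewrite formal_mulUU !formal_evalU -big_split.
by apply: eq_bigr => k _; rewrite ffunE rmorphM.
Qed.

Lemma tensor_eval_map a : tensor_eval (tensor_map B m a) = r a.
Proof.
rewrite tensor_eval_pi formal_evalZ formal_evalU big1 ?mulr1 // => k _.
by rewrite ffunE rmorph1.
Qed.

End TensorEval.

(** * Spanning and symmetrization *)

Section Multilinear.
Variables (A : comNzRingType) (B : algebra A) (m : nat).
Local Notation pure := {ffun 'I_m -> B}.
Local Notation formal := {freeg pure / A}.
Local Notation T := (tensor_power B m).

Definition pure_tensor (x : pure) : T := tensor_pi << x >>.

Definition update (x : pure) (k : 'I_m) (b : B) : pure :=
  [ffun l => if l == k then b else x l].

Lemma tensor_map_mul a u : tensor_map B m a * tensor_pi u = tensor_pi (a *: u).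
Proof. by rewrite -[LHS]tensor_piM formal_mulZl formal_mul1l. Qed.

Lemma tensor_piD (u v : formal) : tensor_pi (u + v) = tensor_pi u + tensor_pi v :> T.
Proof. exact: raddfD. Qed.

Lemma pure_tensor_update_lin (x : pure) k a (b1 b2 : B) :
  pure_tensor (update x k (alg_map B a * b1 + b2)) =
    tensor_map B m a * pure_tensor (update x k b1) + pure_tensor (update x k b2).
Proof.
rewrite tensor_map_mul -raddfD; apply/tensor_piP.
rewrite -(subrKA (<< update x k (alg_map B a * b1) >> + << update x k b2 >>)).
apply: tensor_nullD.
  apply: (tensor_null_add (k := k)); first by rewrite !ffunE eqxx.
  by move=> j jk; rewrite !ffunE (negbTE jk).
rewrite opprD addrACA subrr addr0.
apply: (tensor_null_scale (k := k)); first by rewrite !ffunE eqxx.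
by move=> j jk; rewrite !ffunE (negbTE jk).
Qed.

Lemma pure_tensorM x y : pure_tensor x * pure_tensor y = pure_tensor (pure_mul x y).
Proof. by rewrite -[LHS]tensor_piM formal_mulUU. Qed.

Lemma tensor_perm_pure s x : tensor_perm s (pure_tensor x) = pure_tensor (pure_perm s x).
Proof. by rewrite -tensor_pi_perm [formal_perm _ _]fgliftU. Qed.

Section Span.
Variables (d : nat) (g : 'I_d -> B).
Hypothesis g_span : forall b : B, exists a : 'I_d -> A, b = \sum_j alg_map B (a j) * g j.
Local Notation gen k := (pure_tensor [ffun l => g ((k : {ffun 'I_m -> 'I_d}) l)]).

(** Slots are expanded one at a time: in [WP] those of index at least s already hold generators,
    which is vacuous at s = m and complete at s = 0. *)
Lemma tensor_span (t : T) :
  exists a : {ffun 'I_m -> 'I_d} -> A, t = \sum_k tensor_map B m (a k) * gen k.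
Proof.
pose W (t : T) := exists a : {ffun 'I_m -> 'I_d} -> A, t = \sum_k tensor_map B m (a k) * gen k.
have W0 : W 0 by exists (fun=> 0); rewrite big1 // => k _; rewrite rmorph0 mul0r.
have Wlin a s u : W s -> W u -> W (tensor_map B m a * s + u).
  move=> [b ->] [c ->]; exists (fun k => a * b k + c k).
  rewrite mulr_sumr -big_split; apply: eq_bigr => k _ /=.
  by rewrite rmorphD rmorphM mulrDl mulrA.
have WP s : forall x : pure, (forall l : 'I_m, (s <= l)%N -> exists j, x l = g j) ->
    W (pure_tensor x).
  elim: s => [|s IHs] x xs.
    have xg l : exists j, x l == g j by have [j ->] := xs l isT; exists j.
    exists (fun k => (k == [ffun l => xchoose (xg l)])%:R).
    rewrite (bigD1 [ffun l => xchoose (xg l)]) //= big1 => [|k /negbTE->].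
      rewrite eqxx rmorph1 mul1r addr0; congr pure_tensor; apply/ffunP => l.
      by rewrite !ffunE; apply/eqP; apply: (xchooseP (xg l)).
    by rewrite rmorph0 mul0r.
  have [sm|ms] := ltnP s m; last by apply: IHs => l sl; have := ltn_ord l; lia.
  pose k := Ordinal sm; have [a ak] := g_span (x k).
  have -> : x = update x k (\sum_j alg_map B (a j) * g j).
    by apply/ffunP => l; rewrite ffunE -ak; case: eqP => [->|].
  elim/big_rec: _ => [|j b _ Wb].
    have E : pure_tensor (update x k 0) = 0.
      by have := pure_tensor_update_lin x k 1 0 0; rewrite !rmorph1 !mul1r addr0 => /esym/eqP;
        rewrite -subr_eq0 addrK => /eqP.
    by rewrite E.
  rewrite pure_tensor_update_lin; apply: Wlin => //; apply: IHs => l.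
  rewrite ffunE leq_eqVlt => /orP[/eqP sl|/xs[i xi]].
    by exists j; rewrite (_ : l = k) ?eqxx //; apply: val_inj.
  by case: eqP => _; [exists j|exists i].
rewrite -[t]tensor_reprK; elim/formal_ind: (tensor_repr t) => [|a x u Wu].
  by rewrite raddf0.
rewrite tensor_piD -tensor_map_mul; apply: Wlin => //.
by apply: (WP m) => l; rewrite leqNgt ltn_ord.
Qed.

End Span.

Definition power_sum (y : B) : T := \sum_l pure_tensor (update [ffun=> 1] l y).

Definition symmetrize (t : T) : T := \sum_(s : 'S_m) tensor_perm s t.

Lemma symmetrize_pure_perm s x :
  symmetrize (pure_tensor (pure_perm s x)) = symmetrize (pure_tensor x).
Proof.
rewrite /symmetrize [RHS](reindex_inj (mulIg s)); apply: eq_bigr => s' _ /=.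
rewrite !tensor_perm_pure; congr pure_tensor; apply/ffunP => k.
by rewrite !ffunE permM.
Qed.

(** The power sum is invariant, so under each permutation its terms can be relabelled to multiply
    the slots of x before permuting. *)
Lemma power_sum_mul (y : B) x : power_sum y * symmetrize (pure_tensor x) =
  \sum_l symmetrize (pure_tensor (update x l (y * x l))).
Proof.
rewrite /symmetrize mulr_sumr [RHS]exchange_big; apply: eq_bigr => s _ /=.
rewrite /power_sum mulr_suml [LHS](reindex_inj (@perm_inj _ (s^-1)%g)).
apply: eq_bigr => l _ /=.
rewrite !tensor_perm_pure pure_tensorM; congr pure_tensor; apply/ffunP => k.
rewrite !ffunE -(inj_eq (@perm_inj _ s)) permKV.
by case: eqP => [<-|_]; rewrite ?mul1r.
Qed.

Lemma tensor_permD s (t u : T) : tensor_perm s (t + u) = tensor_perm s t + tensor_perm s u.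
Proof.
have P0 : tensor_perm s (0 : T) = 0 by have := tensor_permB s (0 : T) 0; rewrite !subrr.
by rewrite -{1}[u]opprK tensor_permB -[- u]sub0r tensor_permB P0 sub0r opprK.
Qed.

Lemma tensor_perm_sum s (I : Type) (rs : seq I) (F : I -> T) :
  tensor_perm s (\sum_(i <- rs) F i) = \sum_(i <- rs) tensor_perm s (F i).
Proof.
have P0 : tensor_perm s (0 : T) = 0 by have := tensor_permB s (0 : T) 0; rewrite !subrr.
exact: (big_morph _ (tensor_permD s) P0).
Qed.

Lemma power_sum_sym y : power_sum y \in @sym_tensor_pred A B m.
Proof.
apply/sym_tensorP => s; rewrite /power_sum tensor_perm_sum.
rewrite (reindex_inj (@perm_inj _ s)); apply: eq_bigr => l _ /=.
rewrite tensor_perm_pure; congr pure_tensor; apply/ffunP => k.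
by rewrite !ffunE (inj_eq (@perm_inj _ s)).
Qed.

Lemma symmetrizeD t u : symmetrize (t + u) = symmetrize t + symmetrize u.
Proof. by rewrite /symmetrize -big_split; apply: eq_bigr => s _; rewrite tensor_permD. Qed.

Lemma symmetrize_mapM a t :
  symmetrize (tensor_map B m a * t) = tensor_map B m a * symmetrize t.
Proof.
rewrite /symmetrize mulr_sumr; apply: eq_bigr => s _.
by rewrite tensor_permM tensor_perm_map.
Qed.

Lemma symmetrize_sym t : t \in @sym_tensor_pred A B m -> symmetrize t = t *+ m`!.
Proof.
move=> /sym_tensorP t_sym; rewrite /symmetrize (eq_bigr (fun=> t)) => [|s _]; last exact: t_sym.
by rewrite sumr_const card_Sn.
Qed.

(* If x is 1 from slot s on, then power_sum y * symmetrize x is the sum of the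
   symmetrizations of the tensors obtained from x by multiplying one slot by y;
   the m - s slots from s on contribute equally, so symmetrize (x with y in slot
   s) is a polynomial in power sums, by induction on s. *)
Lemma symmetric_tensor_ind (W : T -> Prop) :
    (forall k, exists a : A, a * k.+1%:R = 1) ->
    (forall a, W (tensor_map B m a)) ->
    (forall t u, W t -> W u -> W (t + u)) -> (forall t u, W t -> W u -> W (t * u)) ->
    (forall y, W (power_sum y)) ->
  forall t, t \in @sym_tensor_pred A B m -> W t.
Proof.
move=> invA WA WD WM WP.
have Wsum (I : finType) (P : pred I) (F : I -> T) :
    (forall i, P i -> W (F i)) -> W (\sum_(i | P i) F i).
  move=> WF; elim/big_rec: _ => [|i t Pi Wt].
    by rewrite -(rmorph0 (tensor_map B m)); apply: WA.
  by apply: WD => //; apply: WF.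
have WN t : W t -> W (- t).
  by move=> Wt; rewrite -mulN1r -(rmorph1 (tensor_map B m)) -rmorphN; apply: (WM) => //; apply: WA.
have Wdiv k t : W (t *+ k.+1) -> W t.
  have [a ak] := invA k; move=> Wt.
  have -> : t = tensor_map B m a * (t *+ k.+1).
    by rewrite -mulr_natl -(rmorph_nat (tensor_map B m)) mulrA -rmorphM ak rmorph1 mul1r.
  by apply: (WM) => //; apply: WA.
have Wpure s : (s <= m)%N -> forall x : pure, (forall l : 'I_m, (s <= l)%N -> x l = 1) ->
    W (symmetrize (pure_tensor x)).
  elim: s => [|s IHs] sm x x1.
    have -> : x = [ffun=> 1] by apply/ffunP => l; rewrite ffunE x1.
    have -> : pure_tensor [ffun=> 1] = 1 :> T by [].
    rewrite symmetrize_sym; last first.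
      by apply/sym_tensorP => s; rewrite -(rmorph1 (tensor_map B m)) tensor_perm_map.
    by rewrite -(rmorph1 (tensor_map B m)) -rmorphMn; apply: WA.
  pose k := Ordinal sm; pose x0 := update x k 1; pose y := x k.
  have x01 (l : 'I_m) : (s <= l)%N -> x0 l = 1.
    move=> sl; rewrite ffunE; case: eqP => // /eqP lk; apply: x1.
    by rewrite ltn_neqAle sl andbT eq_sym.
  have xE : x = update x0 k y by apply/ffunP => l; rewrite !ffunE; case: eqP => // ->.
  apply: (Wdiv (m - s).-1); rewrite prednK ?subn_gt0 //.
  have -> : symmetrize (pure_tensor x) *+ (m - s) = power_sum y * symmetrize (pure_tensor x0)
      - \sum_(l : 'I_m | (l < s)%N) symmetrize (pure_tensor (update x0 l (y * x0 l))).
    rewrite power_sum_mul (bigID (fun l : 'I_m => (l < s)%N)) /= addrAC subrr add0r.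
    rewrite (eq_bigr (fun=> symmetrize (pure_tensor x))) => [|l]; last first.
      rewrite -leqNgt => sl; rewrite x01 // mulr1 -(symmetrize_pure_perm (tperm k l) x).
      congr (symmetrize (pure_tensor _)); apply/ffunP => j; rewrite !ffunE.
      have [->|jl] := eqVneq j l; first by rewrite tpermR.
      have [jk|jk] := eqVneq j k; last by rewrite tpermD // eq_sym.
      rewrite jk tpermL x1 // ltn_neqAle sl andbT; apply: contraNneq jl => e.
      by rewrite jk; apply/eqP/val_inj.
    rewrite -(big_mkord (fun l => ~~ (l < s)%N) (fun=> symmetrize (pure_tensor x))).
    rewrite (big_cat_nat (leq0n s) (ltnW sm)) /= big_nat_cond big_pred0 ?add0r => [|l].
      rewrite big_nat_cond (eq_bigl (fun l => (s <= l < m)%N && true)) => [|l].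
        by rewrite -big_nat_cond sumr_const_nat.
      by rewrite andbT andb_idr // => /andP[sl _]; rewrite -leqNgt.
    by rewrite leq0n /= andbN.
  apply: WD; first by apply: (WM) => //; apply: IHs => //; apply: ltnW.
  apply: WN; apply: Wsum => l ls; apply: IHs => [|j sj]; first exact: ltnW.
  by rewrite ffunE (negbTE (_ : j != l)) ?x01 // -val_eqE /= gtn_eqF // (leq_trans ls).
(* A symmetric t is its own symmetrization divided by m!, and symmetrization is linear, so pure
   tensors suffice. *)
move=> t t_sym; apply: (Wdiv (m`!).-1); rewrite prednK ?fact_gt0 // -symmetrize_sym //.
rewrite -[t]tensor_reprK; elim/formal_ind: (tensor_repr t) => [|a x u Wu].
  rewrite (raddf0 (@tensor_pi A B m)) symmetrize_sym ?mul0rn.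
    by rewrite -(rmorph0 (tensor_map B m)); apply: WA.
  by apply/sym_tensorP => s; rewrite -(rmorph0 (tensor_map B m)) tensor_perm_map.
rewrite tensor_piD -tensor_map_mul symmetrizeD symmetrize_mapM.
apply: WD => //; apply: (WM); first exact: WA.
by apply: (Wpure m) => // l; rewrite leqNgt ltn_ord.
Qed.

End Multilinear.

(** * Comparison on diagonal matrices *)

Lemma multinom_enum (p k : nat) (a : 'X_{1..p}) : mdeg a = k ->
  exists f : {ffun 'I_k -> 'I_p}, forall j, a j = (\sum_l (f l == j))%N.
Proof.
elim: k a => [|k IHk] a ak.
  exists [ffun l => widen_ord (leq0n p) l] => j; rewrite big_ord0.
  by move/eqP: ak; rewrite mdeg_eq0 => /eqP->; rewrite mnm0E.
have [j aj] : exists j, a j != 0%N.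
  apply/existsP; apply: contra_eqT ak; rewrite negb_exists => /forallP a0.
  by rewrite mdegE big1 // => i _; apply/eqP/negPn.
have le_ja : (U_(j) <= a)%MM by rewrite lep1mP.
have [|f fa] := IHk (a - U_(j))%MM.
  by apply/eqP; rewrite -(eqn_add2r 1) -{1}(mdeg1 j) -mdegD submK // ak addn1.
exists [ffun l => if unlift ord0 l is Some l' then f l' else j] => i.
rewrite big_ord_recl ffunE unlift_none -{1}(submK le_ja) mnmDE mnm1E addnC fa; congr addn.
by apply: eq_bigr => l _; rewrite ffunE liftK.
Qed.

Section Spectrum.
Variables (K : numClosedFieldType) (n' m : nat).
Local Notation n := n'.+1.
Local Notation S := {mpoly K[n * n]}.
Local Notation A := (gl_invariant K n).
Local Notation Y := (generic_mx K n).
Local Notation VR := (vector_rep K n).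
Local Notation SR := (sym_rep K n m).
Local Notation B1 := (big_algebra VR).
Local Notation Bm := (big_algebra SR).
Local Notation T := (tensor_power B1 m).

Lemma expr_diag_mx (d : 'rV[K]_n) k i j :
  (diag_mx d ^+ k) i j = (i == j)%:R * d 0 j ^+ k.
Proof.
elim: k i j => [|k IHk] i j; first by rewrite !expr0 mulr1 mxE.
rewrite exprSr -[_ * _]/(_ *m _) mul_mx_diag mxE IHk exprSr mulrA; congr (_ * _ * _).
Qed.

Lemma big_val_in (V : rep_data K n) (x : big_carrier V) : big_val x \in @big_pred K n V.
Proof. by case: x. Qed.

Section AtPoint.
Variable d : 'rV[K]_n.

Definition inv_eval (a : A) : K := eval_at (diag_mx d) (val a).

Fact inv_eval_zmod_morphism : zmod_morphism inv_eval.
Proof. by move=> a b; rewrite /inv_eval !raddfB. Qed.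

Fact inv_eval_monoid_morphism : monoid_morphism inv_eval.
Proof. by split=> [|a b]; rewrite /inv_eval ?rmorph1 ?rmorphM. Qed.

HB.instance Definition _ := GRing.isZmodMorphism.Build A K inv_eval inv_eval_zmod_morphism.
HB.instance Definition _ :=
  GRing.isMonoidMorphism.Build A K inv_eval inv_eval_monoid_morphism.

Lemma eval_span (a : 'I_n -> A) i j :
  eval_at (diag_mx d) ((\sum_k val (a k) *: Y ^+ k) i j) =
    (i == j)%:R * \sum_k inv_eval (a k) * d 0 j ^+ k.
Proof.
rewrite summxE rmorph_sum mulr_sumr; apply: eq_bigr => k _ /=.
rewrite mxE rmorphM mulrCA; congr (_ * _).
transitivity ((map_mx (eval_at (diag_mx d)) (Y ^+ k)) i j); first by rewrite mxE.
have -> : map_mx (eval_at (diag_mx d)) (Y ^+ k) = diag_mx d ^+ k.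
  elim: (k : nat) => [|l IHl]; first by rewrite !expr0 map_mx1.
  by rewrite !exprS -[Y * _]/(Y *m _) map_mxM eval_at_generic IHl.
exact: expr_diag_mx.
Qed.

Lemma big_vector_diag (F : 'M[S]_n) i j : F \in @big_pred K n VR -> i != j ->
  eval_at (diag_mx d) (F i j) = 0.
Proof. by move=> /big_vector_span[a ->] ij; rewrite eval_span (negbTE ij) mul0r. Qed.

Definition coord_eval (j : 'I_n) (x : big_carrier VR) : K :=
  eval_at (diag_mx d) ((big_val x : 'M[S]_n) j j).

Fact coord_eval_zmod_morphism j : zmod_morphism (coord_eval j).
Proof. by move=> x y; rewrite /coord_eval -raddfB; congr eval_at; rewrite !mxE. Qed.

(** A diagonal entry is multiplicative here because the elements of the algebra are diagonal at
    [diag_mx d]. *)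
Fact coord_eval_monoid_morphism j : monoid_morphism (coord_eval j).
Proof.
split=> [|x y]; first by rewrite /coord_eval mxE eqxx rmorph1.
rewrite /coord_eval [X in eval_at _ X]mxE rmorph_sum (bigD1 j) //= big1 ?addr0 ?rmorphM //.
move=> k kj; rewrite rmorphM.
have E : eval_at (diag_mx d) ((big_val x : 'M[S]_n) j k) = 0.
  by apply: big_vector_diag; [apply: big_val_in | rewrite eq_sym].
by rewrite [X in X * _]E mul0r.
Qed.

HB.instance Definition _ j := GRing.isZmodMorphism.Build (big_carrier VR) K
  (coord_eval j) (coord_eval_zmod_morphism j).
HB.instance Definition _ j := GRing.isMonoidMorphism.Build (big_carrier VR) K
  (coord_eval j) (coord_eval_monoid_morphism j).

Lemma coord_eval_map j (a : A) : coord_eval j (alg_map B1 a) = inv_eval a.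
Proof. by rewrite /coord_eval mxE eqxx. Qed.

Definition point_eval (f : {ffun 'I_m -> 'I_n}) : T -> K :=
  tensor_eval inv_eval (fun l => coord_eval (f l) : {rmorphism B1 -> K}).

Lemma point_evalD f t u : point_eval f (t + u) = point_eval f t + point_eval f u.
Proof. by apply: tensor_evalD => l a; apply: coord_eval_map. Qed.

Lemma point_evalB f t u : point_eval f (t - u) = point_eval f t - point_eval f u.
Proof. by apply: tensor_evalB => l a; apply: coord_eval_map. Qed.

Lemma point_evalM f t u : point_eval f (t * u) = point_eval f t * point_eval f u.
Proof. by apply: tensor_evalM => l a; apply: coord_eval_map. Qed.

Lemma point_eval_map f a : point_eval f (tensor_map B1 m a) = inv_eval a.
Proof. by apply: tensor_eval_map => l b; apply: coord_eval_map. Qed.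

Lemma point_eval0 f : point_eval f 0 = 0.
Proof. by have := point_evalB f 0 0; rewrite !subrr. Qed.

Lemma point_eval_sum f (I : Type) (rs : seq I) (F : I -> T) :
  point_eval f (\sum_(i <- rs) F i) = \sum_(i <- rs) point_eval f (F i).
Proof. exact: (big_morph _ (point_evalD f) (point_eval0 f)). Qed.

Lemma point_eval_pure f x : point_eval f (pure_tensor x) = \prod_l coord_eval (f l) (x l).
Proof.
rewrite /point_eval /pure_tensor tensor_eval_pi => [|l a]; last exact: coord_eval_map.
exact: formal_evalU.
Qed.

Lemma point_eval_power_sum f y :
  point_eval f (power_sum m y) = \sum_l coord_eval (f l) y.
Proof.
rewrite point_eval_sum; apply: eq_bigr => l _; rewrite point_eval_pure (bigD1 l) //=.
rewrite ffunE eqxx big1 ?mulr1 // => k kl; rewrite !ffunE (negbTE kl).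
exact: rmorph1.
Qed.

End AtPoint.

Fact gen_pow_subproof (k : 'I_n) : Y ^+ k \in @big_pred K n VR.
Proof.
by have := diff_ext_pow_big (vector_good_rep K n) (ltn_ord k); rewrite vector_diff_ext.
Qed.

Definition gen_pow (k : 'I_n) : B1 := BigCarrier (gen_pow_subproof k).

Lemma big_vector_gen (x : B1) : exists a : 'I_n -> A, x = \sum_k alg_map B1 (a k) * gen_pow k.
Proof.
case: x => F bF; have [a Fa] := big_vector_span bF; exists a; apply: val_inj.
rewrite [RHS]raddf_sum /= Fa; apply: eq_bigr => k _.
by rewrite -mul_scalar_mx.
Qed.

Lemma coord_eval_gen d j k : coord_eval d j (gen_pow k) = d 0 j ^+ k.
Proof.
rewrite /coord_eval /=.
have -> : Y ^+ k = \sum_(l < n) val ((l == k)%:R : A) *: Y ^+ l.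
  rewrite (bigD1 k) //= big1 ?addr0 ?eqxx ?rmorph1 ?scale1r // => l /negbTE->.
  by rewrite rmorph0 scale0r.
rewrite eval_span eqxx mul1r (bigD1 k) //= big1 ?addr0 ?eqxx ?rmorph1 ?mul1r // => l /negbTE->.
by rewrite rmorph0 mul0r.
Qed.

Lemma invariant_eq0 (a : A) :
  (forall d : 'rV[K]_n, injective (d 0) -> inv_eval d a = 0) -> a = 0.
Proof.
move=> a0; apply: val_inj; apply: density => g d gU d_inj.
rewrite gl_invariant_conj //; last by case: a {a0}.
exact: a0.
Qed.

(** Let a_k be coefficients of t on tensors of powers of Y. The values of t at all f arise from the
    a_k(d) by the m-th Kronecker power of the Vandermonde matrix of d, inverted by the Kronecker
    power of its inverse ([VV]). So every a_k vanishes at diagonal matrices with distinct entries,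
    hence is 0. *)
Lemma point_eval_inj (t : T) :
  (forall (d : 'rV[K]_n) f, injective (d 0) -> point_eval d f t = 0) -> t = 0.
Proof.
move=> t0; have [a tE] := tensor_span (m := m) big_vector_gen t.
suff a0 k : a k = 0 by rewrite tE big1 // => k _; rewrite a0 rmorph0 mul0r.
apply: invariant_eq0 => d d_inj; pose V := Vandermonde n d.
have VU : V \in unitmx.
  rewrite unitmxE unitfE det_Vandermonde; apply/prodf_neq0 => i _; apply/prodf_neq0 => j ij.
  by rewrite subr_eq0 (inj_eq d_inj) -val_eqE /= gtn_eqF.
have ptE (f : {ffun 'I_m -> 'I_n}) : \sum_k inv_eval d (a k) * \prod_l V (k l) (f l) = 0.
  apply: etrans (t0 d f d_inj); rewrite tE point_eval_sum; apply: eq_bigr => k' _.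
  rewrite point_evalM point_eval_map point_eval_pure; congr (_ * _).
  by apply: eq_bigr => l _; rewrite ffunE coord_eval_gen mxE.
have VV (k' : {ffun 'I_m -> 'I_n}) :
    \sum_(f : {ffun 'I_m -> 'I_n}) (\prod_l V (k' l) (f l)) * \prod_l (invmx V) (f l) (k l)
      = (k' == k)%:R.
  under eq_bigr => f _ do rewrite -big_split.
  rewrite -(bigA_distr_bigA (fun l j => V (k' l) j * invmx V j (k l))) /=.
  have E l : \sum_j V (k' l) j * invmx V j (k l) = (k' l == k l)%:R.
    by have := congr1 (fun M : 'M[K]_n => M (k' l) (k l)) (mulmxV VU); rewrite !mxE.
  rewrite (eq_bigr _ (fun l _ => E l)); case: eqP => [->|/eqP k'k].
    by rewrite big1 // => l _; rewrite eqxx.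
  have [l kl] : exists l, k' l != k l.
    apply/existsP; apply: contraNT k'k; rewrite negb_exists => /forallP k'k.
    by apply/eqP; apply/ffunP => l; apply/eqP/negPn.
  by rewrite (bigD1 l) //= (negbTE kl) mul0r.
pose Ff := {ffun 'I_m -> 'I_n}.
transitivity (\sum_(f : Ff) (\sum_(k' : Ff) inv_eval d (a k') * \prod_l V (k' l) (f l)) *
    \prod_l (invmx V) (f l) (k l)); last by rewrite big1 // => f _; rewrite ptE mul0r.
under eq_bigr => f _ do rewrite mulr_suml.
rewrite exchange_big /=.
have E k' : \sum_(f : Ff) inv_eval d (a k') * (\prod_l V (k' l) (f l)) *
    \prod_l (invmx V) (f l) (k l) = inv_eval d (a k') * (k' == k)%:R.
  by rewrite -VV mulr_sumr; apply: eq_bigr => f _; rewrite mulrA.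
rewrite (eq_bigr _ (fun k' _ => E k')).
by rewrite (bigD1 k) //= eqxx mulr1 big1 ?addr0 // => k' /negbTE->; rewrite mulr0.
Qed.

Definition weight (f : {ffun 'I_m -> 'I_n}) : 'X_{1..n} := [multinom (\sum_l (f l == j))%N | j < n].

Lemma mdeg_weight f : mdeg (weight f) = m.
Proof.
rewrite mdegE; under eq_bigr => j _ do rewrite mnmE.
rewrite exchange_big (eq_bigr (fun=> 1%N)) ?sum1_card ?card_ord // => l _.
by rewrite (bigD1 (f l)) //= eqxx big1 // => j /negbTE; rewrite eq_sym => ->.
Qed.

Lemma weight_sum f (F : 'I_n -> K) : \sum_j (weight f j)%:R * F j = \sum_l F (f l).
Proof.
under eq_bigr => j _ do rewrite mnmE natr_sum mulr_suml.
rewrite exchange_big; apply: eq_bigr => l _.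
rewrite (bigD1 (f l)) //= eqxx mul1r big1 ?addr0 // => j /negbTE.
by rewrite eq_sym => ->; rewrite mul0r.
Qed.

(* F restricted to the diagonal matrices is diagonal, and its eigenvalue on the
   monomial of weight f is the value of t at the point (d_(f 0), d_(f 1), ...). *)
Definition corresponds (F : 'M[S]_(rep_dim SR)) (t : T) : Prop :=
  forall (d : 'rV[K]_n) (f : {ffun 'I_m -> 'I_n}) (a b : 'I_#|monomials n m|),
    monomial a = weight f ->
  eval_at (diag_mx d) (F a b) = (a == b)%:R * point_eval d f t.

Lemma correspondsD F G t u : corresponds F t -> corresponds G u -> corresponds (F + G) (t + u).
Proof.
move=> Ft Gu d f a b af; rewrite mxE rmorphD /= (Ft _ _ _ _ af) (Gu _ _ _ _ af).
by rewrite -mulrDr -point_evalD.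
Qed.

Lemma correspondsB F G t u : corresponds F t -> corresponds G u -> corresponds (F - G) (t - u).
Proof.
move=> Ft Gu d f a b af; rewrite !mxE rmorphB /= (Ft _ _ _ _ af) (Gu _ _ _ _ af) -mulrBr.
by rewrite -point_evalB.
Qed.

Lemma correspondsM F G (t u : T) :
  corresponds F t -> corresponds G u -> corresponds (F *m G) (t * u).
Proof.
move=> Ft Gu d f a b af; rewrite mxE rmorph_sum (bigD1 a) //= big1 => [|c ca].
  rewrite addr0 rmorphM /= (Ft _ _ _ _ af) (Gu _ _ _ _ af) eqxx mul1r mulrCA.
  by rewrite -point_evalM.
by rewrite rmorphM /= (Ft _ _ _ _ af) eq_sym (negbTE ca) !mul0r.
Qed.

Lemma corresponds_map a : corresponds (val a)%:M (tensor_map B1 m a).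
Proof.
move=> d f i j _; rewrite point_eval_map mxE /inv_eval mulr_natl.
by case: eqP => _; rewrite ?mulr1n ?mulr0n ?rmorph0.
Qed.

Lemma corresponds_power_sum (y : B1) :
  corresponds (diff_ext SR (big_val y : 'M[S]_n)) (power_sum m y).
Proof.
move=> d f a b af; rewrite point_eval_power_sum.
transitivity ((map_mx (eval_at (diag_mx d)) (diff_ext SR (big_val y : 'M[S]_n))) a b).
  by rewrite [RHS]mxE.
rewrite (eval_diff_ext (sym_good_rep K n m)) /= mxE.
set M := map_mx _ _; have M_diag i j : M i j = (i == j)%:R * coord_eval d j y.
  rewrite mxE /coord_eval; case: eqP => [->|/eqP ij]; first by rewrite mul1r.
  by rewrite [LHS]big_vector_diag ?mul0r //; exact: (big_val_in (y : big_carrier VR)).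
have -> : sym_deriv M 'X_[monomial b] =
    (\sum_j (monomial b j)%:R * coord_eval d j y) *: 'X_[monomial b].
  rewrite scaler_suml; apply: eq_bigr => j _.
  rewrite (bigD1 j) //= big1 ?addr0 => [|i ij]; last by rewrite M_diag (negbTE ij) mul0r scale0r.
  rewrite M_diag eqxx mul1r mderivX -scalerAl -scalerAr scalerA mulrC -mpolyXD addmC.
  (* For exponent 0 the subtraction of [U_(j)] is truncated, but the coefficient is then 0. *)
  have [->|bj] := eqVneq (monomial b j) 0%N; first by rewrite mul0r !scale0r.
  by rewrite submK // lep1mP.
rewrite mcoeffZ mcoeffX (inj_eq (@monomial_inj _ _)) eq_sym mulrC.
by case: eqP => [<-|_]; rewrite ?mul0r // !mul1r af weight_sum.
Qed.

Lemma weight_surj (a : 'X_{1..n}) : mdeg a = m -> exists f, weight f = a.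
Proof.
by move=> /multinom_enum[f fa]; exists f; apply/mnmP => j; rewrite mnmE fa.
Qed.

Lemma corresponds_inj_tensor F t u : corresponds F t -> corresponds F u -> t = u.
Proof.
move=> Ft Fu; apply/eqP; rewrite -subr_eq0; apply/eqP/point_eval_inj => d f _.
have [a af] := monomial_surj (mdeg_weight f).
have := Ft d f a a af; rewrite (Fu d f a a af) eqxx !mul1r point_evalB => ->.
exact: subrr.
Qed.

Lemma corresponds_inj_big F G t :
    F \in @big_pred K n SR -> G \in @big_pred K n SR ->
  corresponds F t -> corresponds G t -> F = G.
Proof.
move=> bF bG Ft Gt; apply/eqP; rewrite -subr_eq0; apply/eqP.
have bFG : F - G \in @big_pred K n SR by have [_ bB _] := @big_subring_closed K n SR; apply: bB.
apply: (equivariant_eq0 (big_equivariant (sym_good_rep K n m) bFG)) => d _.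
apply/matrixP => a b; have [f fa] := weight_surj (mdeg_monomial a).
by rewrite !mxE rmorphB /= (Ft d f) // (Gt d f) // subrr.
Qed.

(** A generator pi(G_k) is matched by the power sum of G_k, seen as an element of the big algebra of
    the vector representation. *)
Lemma corresponds_of_big F : F \in @big_pred K n SR ->
  exists t : sym_tensor B1 m, corresponds F (val t).
Proof.
move=> bF; pose P (G : 'M[S]_(rep_dim SR)) :=
  exists t : sym_tensor B1 m, corresponds G (val t).
suff [] : P F /\ equivariant F by [].
apply: (big_pred_ind (sym_good_rep K n m)) bF => [|k kn].
  split=> [a|G H [t Gt] [u Hu]|G H [t Gt] [u Hu]].
  - by exists (sym_tensor_map B1 m a); apply: corresponds_map.
  - by exists (t + u); rewrite raddfD; apply: correspondsD.
  - by exists (t * u); rewrite rmorphM; apply: correspondsM.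
have bg : char_grad K n k \in @big_pred K n VR.
  by have := @diff_ext_grad_big K n VR k kn; rewrite vector_diff_ext.
pose y : B1 := BigCarrier bg.
by exists (SymTensor (power_sum_sym m y)); apply: (corresponds_power_sum y).
Qed.

(** The power sum of y is matched by pi(y), which is in the big algebra because y is a combination
    of 1, Y, ..., Y^(n-1) with invariant coefficients. *)
Lemma big_of_corresponds (t : T) : t \in @sym_tensor_pred _ B1 m ->
  exists F : big_carrier SR, corresponds (big_val F) t.
Proof.
have [bA bD bM] := @big_subalgebra K n SR.
suff : t \in @sym_tensor_pred _ B1 m ->
    exists2 F, F \in @big_pred K n SR & corresponds F t.
  by move=> H /H[F bF Ft]; exists (BigCarrier bF).
move: t; apply: (@symmetric_tensor_ind _ B1 m
  (fun t => exists2 F, F \in @big_pred K n SR & corresponds F t))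
  => [k|a|t u [F bF Ft] [G bG Gu]|t u [F bF Ft] [G bG Gu]|y].
- exists (const_inv n (k.+1%:R^-1 : K)); apply: val_inj.
  rewrite rmorphM rmorph1 rmorph_nat /= -(rmorph_nat (@const_mpoly K n)) -rmorphM.
  by rewrite mulVf ?rmorph1 // pnatr_eq0.
- by exists (val a)%:M; [apply: bA|apply: corresponds_map].
- by exists (F + G); [apply: bD|apply: correspondsD].
- by exists (F *m G); [apply: bM|apply: correspondsM].
exists (diff_ext SR (big_val y : 'M[S]_n)); last exact: corresponds_power_sum.
have [a ->] := big_vector_span (big_val_in (y : big_carrier VR)).
elim/big_rec: _ => [|k M _ bM'].
  by rewrite diff_ext0; have := bA 0; rewrite !raddf0.
rewrite [diff_ext _ _]raddfD /=; apply: (bD) => //.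
rewrite diff_extZ -mul_scalar_mx; apply: (bM); first exact: bA.
exact: (diff_ext_pow_big (sym_good_rep K n m)).
Qed.

(** Partners under [corresponds] exist on both sides and are unique, so choosing one defines a
    bijection; uniqueness also turns compatibility with the operations into the morphism laws. *)
Lemma big_sym_isom : alg_isom Bm (sym_tensor_alg B1 m).
Proof.
have fP (F : big_carrier SR) : {t : sym_tensor B1 m | corresponds (big_val F) (val t)}.
  by apply: cid; apply: corresponds_of_big; apply: big_val_in.
pose f (F : big_carrier SR) : sym_tensor B1 m := sval (fP F).
have fE F t : corresponds (big_val F) (val t) -> f F = t.
  by move=> Ft; apply: val_inj; apply: corresponds_inj_tensor (svalP (fP F)) Ft.
have f_zmod : zmod_morphism f.
  move=> F G; apply: fE; rewrite raddfB.
  exact: correspondsB (svalP (fP F)) (svalP (fP G)).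
have f_mon : monoid_morphism f.
  split=> [|F G]; apply: fE; rewrite ?rmorph1 ?rmorphM.
    have := corresponds_map 1; rewrite !rmorph1; exact.
  exact: correspondsM (svalP (fP F)) (svalP (fP G)).
pose f' : {rmorphism Bm -> sym_tensor_alg B1 m} := HB.pack f
  (GRing.isZmodMorphism.Build (big_carrier SR) (sym_tensor B1 m) f f_zmod)
  (GRing.isMonoidMorphism.Build (big_carrier SR) (sym_tensor B1 m) f f_mon).
exists f'; split; last by move=> a; apply: fE; apply: corresponds_map.
have gP (t : sym_tensor B1 m) : {F : big_carrier SR | corresponds (big_val F) (val t)}.
  by apply: cid; apply: big_of_corresponds; case: t.
exists (fun t => sval (gP t)) => [F|t].
  apply: val_inj; apply: corresponds_inj_big (svalP (gP (f F))) (svalP (fP F)).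
    exact: big_val_in.
  exact: big_val_in.
exact: fE (svalP (gP t)).
Qed.

End Spectrum.

Theorem theorem1p2 (R : realType) (n m : nat) (hn : (1 <= n)%N) (hm : (1 <= m)%N) :
  alg_isom (big_algebra (sym_rep R[i] n m))
           (sym_tensor_alg (big_algebra (vector_rep R[i] n)) m).
Proof. by case: n hn => // n' _; apply: big_sym_isom. Qed.
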